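(* One has $$\sum_{g=2}^\infty\chi(\overline{\mathcal M}_{g,0})\,z^{2-2g}=\log\Big(e^{\frac12\tilde d_V^2}e^{G_0(z)}\Big)=e^{\frac12\widehat A}\,G_0(z),$$ or equivalently, for every $g\ge2$, $$\chi(\overline{\mathcal M}_{g,0})=\Big[\log\Big(e^{\frac12\tilde d_V^2}e^{G_0(z)}\Big)\Big]_{z^{2-2g}}=\Big[e^{\frac12\widehat A}G_0(z)\Big]_{z^{2-2g}},$$ where $[\cdot]_{z^{2-2g}}$ denotes the coefficient of $z^{2-2g}$.
   Context: For $2g-2+n>0$, $\chi(\mathcal M_{g,n})=(-1)^n\frac{(2g-1)B_{2g}}{(2g)!}(2g+n-3)!$ is the orbifold Euler characteristic of $\mathcal M_{g,n}$ (Harer–Zagier formula), and $\chi(\overline{\mathcal M}_{g,n})$ is the orbifold Euler characteristic of the Deligne–Mumford moduli space of stable curves; by Bini–Harer, $\chi(\overline{\mathcal M}_{g,n})=n!\sum_{\Gamma}\frac1{|\mathrm{Aut}(\Gamma)|}\prod_{v}\chi(\mathcal M_{g_v,\mathrm{val}_v})$, the sum being over isomorphism classes of connected stable graphs of genus $g$ with $n$ unlabelled external edges (vertices $v$ have genus $g_v$ and valence $\mathrm{val}_v$ with $2g_v-2+\mathrm{val}_v>0$; the genus of $\Gamma$ is $h^1(\Gamma)+\sum_vg_v$). Define formal series in $z^{-1}$: $V_0(z)=G_0(z):=\sum_{g\ge2}\chi(\mathcal M_{g,0})z^{2-2g}$, $V_n(z):=\sum_{g\ge1}\chi(\mathcal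 M_{g,n})z^{2-2g-n}$ for $n=1,2$, and $V_n(z):=\sum_{g\ge0}\chi(\mathcal M_{g,n})z^{2-2g-n}$ for $n\ge3$. The operators act on expressions in formal variables $G_0=V_0,V_1,V_2,\dots$: $$\tilde d_V=V_1\frac{\partial}{\partial G_0}+\sum_{l\ge1}V_{l+1}\frac{\partial}{\partial V_l},$$ $$\widehat A=\sum_{m\ge1}V_m\Big(\sum_{k\ge0}\binom{m+k-1}{k}V_{k+1}\frac{\partial}{\partial V_{m+k-1}}+\frac{\partial}{\partial V_{m-2}}\Big),\qquad \frac{\partial}{\partial V_{-1}}:=0.$$ Convention: the $V_n$ and $G_0=V_0$ are treated as independent formal variables while the operators are applied; afterwards one substitutes $V_n=V_n(z)$, $G_0=G_0(z)$. Precisely, $\log(e^{\frac12\tilde d_V^2}e^{G_0})$ and $e^{\frac12\widehat A}G_0$ are the values at $\lambda=1$ of the formal power series $\log(e^{\frac12\lambda^2\tilde d_V^2}e^{G_0})$ and $e^{\frac12\lambda^2\widehat A}G_0$ in $\lambda^2$ (whose coefficients are polynomials in the $V_n$), after that substitution; for each fixed power of $z$ only finitely many powers of $\lambda^2$ contribute. *)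

(* Defs.v *)
From HB Require Import structures.
From mathcomp Require Import boolp classical_sets functions cardinality fsbigop.
From mathcomp Require Import finmap.
From mathcomp Require Import all_boot all_order all_algebra all_fingroup zify.
From mathcomp.multinomials Require Import monalg.

Set Implicit Arguments.
Unset Strict Implicit.
Unset Printing Implicit Defensive.

Import GRing.Theory Num.Theory.
Local Open Scope ring_scope.

(* bernoulli_seq n = [:: B_0; ...; B_(n-1)], from
   \sum_(k <= n) 'C(n.+1, k) B_k = (n == 0), so that B_1 = - 1/2. *)
Fixpoint bernoulli_seq (n : nat) : seq rat :=
  if n is n'.+1 then
    let s := bernoulli_seq n' in
    rcons s (((n' == 0)%:R - \sum_(k < n') 'C(n'.+1, k)%:R * s`_k) / n'.+1%:R)
  else [::].

Definition bernoulli (n : nat) : rat := (bernoulli_seq n.+1)`_n.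

Lemma size_bernoulli_seq n : size (bernoulli_seq n) = n.
Proof. by elim: n => //= n IHn; rewrite size_rcons IHn. Qed.

Lemma nth_bernoulli_seq n k : (k < n)%N -> (bernoulli_seq n)`_k = bernoulli k.
Proof.
elim: n => // n IHn; rewrite ltnS leq_eqVlt => /predU1P[-> //|lt_kn].
by rewrite /= nth_rcons size_bernoulli_seq lt_kn IHn.
Qed.

Lemma bernoulli_sum n :
  \sum_(k < n.+1) 'C(n.+1, k)%:R * bernoulli k = (n == 0)%:R.
Proof.
have n1 : n.+1%:R != 0 :> rat by rewrite pnatr_eq0.
rewrite big_ord_recr /= {2}/bernoulli /= nth_rcons size_bernoulli_seq ltnn eqxx.
rewrite binSn mulrC divfK //.
rewrite (eq_bigr (fun k : 'I_n => 'C(n.+1, k)%:R * bernoulli k)) => [|k _].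
  under [X in _ - X]eq_bigr => k _ do rewrite nth_bernoulli_seq //.
  by rewrite addrC subrK.
by [].
Qed.

(* The orbifold Euler characteristic of M_{g,n}, given by the Harer-Zagier
   formula; only meaningful for 2 < 2 * g + n. *)
Definition chiM (g n : nat) : rat :=
  (-1) ^+ n * ((2 * g)%:R - 1) * bernoulli (2 * g) / (2 * g)`!%:R
  * (2 * g + n - 3)`!%:R.

(* A graph with vertex set V and half-edge set H: [hopp] is to be an involution
   whose 2-cycles are the internal edges and whose fixed points are the
   (unlabelled) external edges. *)
Record wgraph (V H : finType) := WGraph {
  att : H -> V;
  hopp : H -> H;
  gen : V -> nat }.

Section Graphs.
Variables (V H : finType).
Implicit Types G : wgraph V H.

Definition valence G (v : V) : nat := #|[set x | att G x == v]|.

Definition external G : {set H} := [set x | hopp G x == x].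

Definition edges G : {set {set H}} :=
  [set [set x; hopp G x] | x in ~: external G].

Definition adj G : rel V :=
  [rel u v | [exists x, (att G x == u) && (att G (hopp G x) == v)]].

(* [ncomp], b0, is the number of connected components and [h1] the first Betti
   number E - V + b0; integers avoid truncated subtraction. *)
Definition ncomp G : nat := n_comp (adj G) predT.

Definition h1 G : int := #|edges G|%:Z - #|V|%:Z + (ncomp G)%:Z.

Definition genus G : int := h1 G + (\sum_v gen G v)%N%:Z.

Definition stable_graph (g n : nat) G : bool :=
  [&& [forall x, hopp G (hopp G x) == x],
      ncomp G == 1%N,
      genus G == g%:Z,
      #|external G| == n
    & [forall v, 2 < 2 * gen G v + valence G v]%N].

Definition is_iso G G' (s : {perm V}) (t : {perm H}) : bool :=
  [&& [forall x, att G' (t x) == s (att G x)],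
      [forall x, hopp G' (t x) == t (hopp G x)]
    & [forall v, gen G' (s v) == gen G v]].

Definition isomorphic G G' : bool :=
  [exists s : {perm V}, [exists t : {perm H}, is_iso G G' s t]].

Definition Aut G : {set {perm V} * {perm H}} := [set st | is_iso G G st.1 st.2].

Definition weight G : rat :=
  #|Aut G|%:R^-1 * \prod_v chiM (gen G v) (valence G v).

Lemma sum_valence G : (\sum_v valence G v = #|H|)%N.
Proof.
rewrite -sum1_card (partition_big (att G) predT) //=.
by apply: eq_bigr => v _; rewrite sum1_card; apply: eq_card => x; rewrite !inE.
Qed.

Lemma card_edges G : (forall x, hopp G (hopp G x) = x) ->
  #|H| = (#|external G| + 2 * #|edges G|)%N.
Proof.
move=> oppK; rewrite -(cardsC (external G)); congr addn.
have part : partition (edges G) (~: external G).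
  apply/and3P; split.
  - rewrite eqEsubset; apply/andP; split; apply/subsetP => x.
      case/bigcupP=> B /imsetP[y]; rewrite !inE => ny ->.
      by rewrite !inE => /orP[/eqP-> //|/eqP->]; rewrite oppK eq_sym.
    move=> nx; apply/bigcupP; exists [set x; hopp G x].
      by apply/imsetP; exists x.
    by rewrite !inE eqxx.
  - apply/trivIsetP => A B /imsetP[x _ ->] /imsetP[y _ ->]; apply: contraR.
    case/pred0Pn=> z /=; rewrite !inE => /andP[].
    move=> /orP[] /eqP-> /orP[] /eqP; rewrite ?oppK.
    - by move->.
    - by move->; rewrite oppK setUC.
    - by move<-; rewrite oppK setUC.
    - by move=> /(congr1 (hopp G)); rewrite !oppK => ->.
  - by apply/imsetP=> -[x _ /setP/(_ x)]; rewrite !inE eqxx.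
rewrite (card_partition part) (eq_bigr (fun=> 2%N)) => [|B].
  by rewrite sum_nat_const mulnC.
by case/imsetP=> x; rewrite !inE eq_sym => nx ->; rewrite cards2 nx.
Qed.

Lemma stable_graph_bounds g n G : stable_graph g n G ->
  [/\ (#|V| <= 2 * g + n - 2)%N, (#|H| <= 3 * (2 * g + n - 2))%N
    & forall v, (gen G v <= g + n)%N].
Proof.
case/and5P=> /forallP oppK /eqP c1 /eqP gE /eqP nE /forallP st.
have cE : #|H| = (n + 2 * #|edges G|)%N.
  by rewrite -nE; apply: card_edges => x; apply/eqP.
have sE : (\sum_v (2 * gen G v + valence G v) + 2 = 2 * g + n + 2 * #|V|)%N.
  rewrite big_split /= sum_valence cE -big_distrr /=.
  move: gE; rewrite /genus /h1 c1.
  move: (\sum_v gen G v)%N #|edges G| #|V| => a b c; lia.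
have le3 (P : pred V) :
    (3 * #|P| <= \sum_(v | P v) (2 * gen G v + valence G v))%N.
  by rewrite -sum1_card big_distrr leq_sum.
have leV : (#|V| + 2 <= 2 * g + n)%N.
  move: sE (le3 predT); rewrite -[#|predT|]/#|V|.
  by move: (\sum_v _)%N #|V| => a b; lia.
have leH : (#|H| <= \sum_v (2 * gen G v + valence G v))%N.
  by rewrite -(sum_valence G) leq_sum // => v _; apply: leq_addl.
split=> [||v]; first by move: leV; move: #|V| => a; lia.
  by move: sE leV leH; move: (\sum_v _)%N #|V| #|H| => a b c; lia.
have V0 : (0 < #|V|)%N by apply/card_gt0P; exists v.
move: sE (le3 (predC1 v)) leV V0; rewrite (bigD1 v) //= cardC1.
by move: (\sum_(i | _) _)%N #|V| (gen G v) (valence G v) => a b c d; lia.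
Qed.
End Graphs.

(* Graphs with vertices 'I_k and half-edges 'I_m and with vertex genera at most
   b, as a finite type. *)
Definition gcode (b k m : nat) : finType :=
  ({ffun 'I_m -> 'I_k} * {ffun 'I_m -> 'I_m} * {ffun 'I_k -> 'I_b.+1})%type.

Definition decode b k m (c : gcode b k m) : wgraph 'I_k 'I_m :=
  WGraph c.1.1 c.1.2 (fun v => c.2 v : nat).

(* One graph from each isomorphism class of stable graphs of genus g with n
   external edges, k vertices and m half-edges; see [stable_graph_bounds] for
   the bound on the vertex genera. *)
Definition stable_graph_reps (g n k m : nat) : {set gcode (g + n) k m} :=
  let D := [set c : gcode (g + n) k m | stable_graph g n (decode c)] in
  transversal
    (equivalence_partition (fun c c' => isomorphic (decode c) (decode c')) D) D.

(* The orbifold Euler characteristic of the moduli space of stable curves,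
   given by the Bini-Harer formula. By [stable_graph_bounds], the ranges of the
   numbers k of vertices and m of half-edges omit no stable graph. *)
Definition chiMbar (g n : nat) : rat :=
  n`!%:R * \sum_(k < (2 * g + n - 2).+1)
           \sum_(m < (3 * (2 * g + n - 2)).+1)
           \sum_(c in stable_graph_reps g n k m) weight (decode c).

Record fps (R : Type) := Fps { coefs :> nat -> R }.

HB.instance Definition _ (R : Type) := gen_eqMixin (fps R).
HB.instance Definition _ (R : Type) := gen_choiceMixin (fps R).

Lemma fpsP (R : Type) (f g : fps R) : f =1 g -> f = g.
Proof. by case: f g => [f] [g] /= /funext ->. Qed.

Section FpsZmod.
Variable R : zmodType.
Implicit Types f g h : fps R.

Definition fps_zero : fps R := Fps (fun=> 0).
Definition fps_opp f : fps R := Fps (fun n => - f n).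
Definition fps_add f g : fps R := Fps (fun n => f n + g n).

Lemma fps_addA : associative fps_add.
Proof. by move=> f g h; apply: fpsP => n; apply: addrA. Qed.
Lemma fps_addC : commutative fps_add.
Proof. by move=> f g; apply: fpsP => n; apply: addrC. Qed.
Lemma fps_add0 : left_id fps_zero fps_add.
Proof. by move=> f; apply: fpsP => n; apply: add0r. Qed.
Lemma fps_addN : left_inverse fps_zero fps_opp fps_add.
Proof. by move=> f; apply: fpsP => n; apply: addNr. Qed.

HB.instance Definition _ := GRing.isZmodule.Build (fps R)
  fps_addA fps_addC fps_add0 fps_addN.
End FpsZmod.

Section FpsRing.
Variable R : comNzRingType.
Implicit Types f g h : fps R.

Definition fpsC (c : R) : fps R := Fps (fun n => if n is 0%N then c else 0).
Definition fpsX : fps R := Fps (fun n => (n == 1%N)%:R).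
Definition fps_mul f g : fps R :=
  Fps (fun n => \sum_(i < n.+1) f i * g (n - i)%N).

Let trunc n f : {poly R} := \poly_(i < n.+1) f i.

Let mulE n f g i : (i <= n)%N -> fps_mul f g i = (trunc n f * trunc n g)`_i.
Proof.
move=> le_in; rewrite coefM; apply: eq_bigr => j _; rewrite !coef_poly !ltnS.
have le_jn : (j <= n)%N by apply: leq_trans le_in; rewrite -ltnS ltn_ord.
by rewrite le_jn (leq_trans (leq_subr j i) le_in).
Qed.

Lemma fps_mulA : associative fps_mul.
Proof.
move=> f g h; apply: fpsP => n.
transitivity ((trunc n f * (trunc n g * trunc n h))`_n).
  rewrite coefM; apply: eq_bigr => i _; rewrite coef_poly ltn_ord.
  by rewrite -(mulE _ _ (leq_subr i n)).
rewrite mulrA coefM; apply: eq_bigr => i _.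
by rewrite -(mulE _ _ (leq_ord i)) coef_poly ltnS leq_subr.
Qed.
Lemma fps_mulC : commutative fps_mul.
Proof. by move=> f g; apply: fpsP => n; rewrite !(mulE _ _ (leqnn n)) mulrC. Qed.
Lemma fps_mul1 : left_id (fpsC 1) fps_mul.
Proof.
move=> f; apply: fpsP => n /=; rewrite big_ord_recl subn0 mul1r big1 ?addr0 //.
by move=> i _; rewrite mul0r.
Qed.
Lemma fps_mulDl : left_distributive fps_mul +%R.
Proof.
move=> f g h; apply: fpsP => n /=; rewrite -big_split.
by apply: eq_bigr => i _; apply: mulrDl.
Qed.
Lemma fps_1neq0 : fpsC 1 != 0.
Proof.
by apply/eqP=> /(congr1 (fun f : fps R => f 0%N))/eqP; rewrite (negPf (oner_neq0 R)).
Qed.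

HB.instance Definition _ := GRing.Zmodule_isComNzRing.Build (fps R)
  fps_mulA fps_mulC fps_mul1 fps_mulDl fps_1neq0.
End FpsRing.

(* The sum of a family of power series that is locally finite, i.e. such that
   for each exponent only finitely many members of the family have a nonzero
   coefficient; the coefficients of [lsum] that involve infinitely many members
   are 0 by convention. The sums in [dtilde], [Ahat], [fps_log] and [substV]
   below are locally finite: a given polynomial involves finitely many
   variables, F - 1 has no constant coefficient, and neither has V_0(z). *)
Definition locally_finite (R : zmodType) (D : set nat) (u : nat -> fps R) : Prop :=
  forall a, finite_set [set i | D i /\ u i a != 0]%classic.

Definition lsum (R : zmodType) (D : set nat) (u : nat -> fps R) : fps R :=
  Fps (fun a => \sum_(i \in D) u i a).

(* The formal variables V_0 = G_0, V_1, V_2, ... live in the ring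
   rat[V_1, V_2, ...][[V_0]], which contains all polynomials in them as well as
   e^(G_0) and is stable under the operators. The variable V_(i+1) is the
   variable of index i of [polyV]. *)
Notation polyV := {malg rat[{cmonom nat}]}.
Notation exprV := (fps polyV).

Definition Vvar (n : nat) : exprV :=
  if n is i.+1 then fpsC << ucm i >> else fpsX polyV.

Definition polyV_deriv (i : nat) (p : polyV) : polyV :=
  \sum_(m <- msupp p) << p@_m *+ m i *g divcm m (ucm i) >>.

Definition dV (n : nat) (f : exprV) : exprV :=
  if n is i.+1 then Fps (fun a => polyV_deriv i (f a))
  else Fps (fun a => f a.+1 *+ a.+1).

Definition dtilde (f : exprV) : exprV :=
  Vvar 1 * dV 0 f
  + lsum [set l | (1 <= l)%N]%classic (fun l => Vvar l.+1 * dV l f).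

(* The derivation d/dV_(m-2), zero when m = 1. *)
Definition dV_minus2 (m : nat) (f : exprV) : exprV :=
  if m is m'.+2 then dV m' f else 0.

Definition Ahat (f : exprV) : exprV :=
  lsum [set m | (1 <= m)%N]%classic (fun m =>
    Vvar m *
    (lsum [set: nat]%classic (fun k => (Vvar k.+1 * dV (m + k - 1) f) *+ 'C(m + k - 1, k))
     + dV_minus2 m f)).

(* e^(G_0) *)
Definition expG0 : exprV := Fps (fun a => (a`!%:R^-1)%:MP).

(* e^(1/2 lambda^2 D) f, as a power series in lambda^2. *)
Definition exp_half (D : exprV -> exprV) (f : exprV) : fps exprV :=
  Fps (fun k => Fps (fun a => (2 ^ k * k`!)%:R^-1 *: iter k D f a)).

(* The Mercator series of log F in rat[V_1, V_2, ...][[V_0, lambda^2]], where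
   F has constant coefficient 1. *)
Definition fps_log (F : fps exprV) : fps exprV :=
  Fps (fun k => Fps (fun a =>
    \sum_(j \in [set j | (1 <= j)%N]%classic)
      ((-1) ^+ j.+1 / j%:R) *: ((F - 1) ^+ j) k a)).

(* V_n(z), as a power series in z^-1: the coefficient of z^-N is the sum of
   chi(M_{g,n}) over the g >= Vgmin n with 2 - 2g - n = - N. *)
Definition Vgmin (n : nat) : nat :=
  if n is 0%N then 2 else if (n <= 2)%N then 1 else 0.

Definition Vseries (n : nat) : fps rat :=
  Fps (fun N => \sum_(Vgmin n <= g < N.+2 | (2 * g + n == N + 2)%N) chiM g n).

(* The substitution V_n := V_n(z). *)
Definition polyV_subst (p : polyV) : fps rat :=
  \sum_(m <- msupp p)
    fpsC p@_m * \prod_(i <- finsupp (cmonom_val m)) Vseries i.+1 ^+ m i.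

Definition substV (f : exprV) : fps rat :=
  lsum [set: nat]%classic (fun a => polyV_subst (f a) * Vseries 0 ^+ a).

(* The coefficients, after substitution, of log(e^(1/2 lambda^2 d^2) e^(G_0))
   and of e^(1/2 lambda^2 A) G_0 at the powers of lambda^2. *)
Definition log_terms (k : nat) : fps rat :=
  substV (fps_log (exp_half (fun f => dtilde (dtilde f)) expG0) k).

Definition Ahat_terms (k : nat) : fps rat :=
  substV (exp_half Ahat (Vvar 0) k).

(* The values at lambda = 1. *)
Definition log_series : fps rat := lsum [set: nat]%classic log_terms.

Definition Ahat_series : fps rat := lsum [set: nat]%classic Ahat_terms.

(* \sum_(g >= 2) chi(Mbar_{g,0}) z^(2-2g), as a power series in z^-1. *)
Definition chiMbar_series : fps rat :=
  Fps (fun N => \sum_(2 <= g < N.+2 | (2 * g == N + 2)%N) chiMbar g 0).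

(* Main.v *)
From HB Require Import structures.
Require Import Defs.
From mathcomp Require Import boolp classical_sets cardinality fsbigop.
From mathcomp Require Import finmap.
From mathcomp Require Import all_boot all_algebra all_fingroup zify ring.
From mathcomp.multinomials Require Import monalg.
Set Implicit Arguments.
Unset Strict Implicit.
Unset Printing Implicit Defensive.
Import GRing.Theory Num.Theory.
Local Open Scope ring_scope.

(** Both operators are vector fields on the space of jets (V_0, V_1, ...) of a
    function V of one variable x, where V_n stands for the n-th derivative.

    Since d~ V_n = V_(n+1), the operator d~ is the total derivative d/dx, and
    U = e^(t d~^2 / 2) e^(V_0) solves the heat equation dU/dt = 1/2 d~^2 U.
    Hence its logarithm L satisfies dL/dt = 1/2 (d~^2 L + (d~ L)^2) with initial
    value V_0 ([Lser_pde], [Lser0]). On the other side, A^ is the evolutionary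
    vector field with A^ V_n = d~^n (V_2 + V_1^2) ([Aop_evar]); it commutes with
    d~, so that e^(t A^ / 2) is a ring morphism commuting with d~, and applying
    it to A^ V_0 = d~^2 V_0 + (d~ V_0)^2 shows that W = e^(t A^ / 2) V_0 satisfies
    the same equation ([Wser_pde]). The equation determines the coefficients
    recursively, so L = W ([Lser_Wser]), already before the substitution.

    The series U is also a sum over graphs. The Leibniz rule gives
    d~^m V_0^k as the sum over all maps a from m half-edges to k vertices of
    the product over the vertices v of V_(valence of v) ([iter_Dop_evar0X]), and
    1/(2^e e!) is the number of perfect matchings of 2e half-edges divided by
    (2e)! ([num_fpfE]). So U sums over all labelled graphs with the weight
    1/(k! m!). Marking a half-edge and splitting off its component
    ([sum_by_component]) yields the identity m a_m = \sum_j j c_j a_(m-j)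
    between the generating functions of all and of connected graphs
    ([exp_formula]), which says that t dL/dt U = t dU/dt when L sums over
    connected graphs ([Lser_conn_total]).

    Finally, substituting V_n(z) for V_n distributes genera over the vertices,
    and the exponent of 1/z becomes the sum over the vertices of
    2 g_v - 2 + val_v, which is 2g - 2 for a connected graph of genus g
    ([conn_sum_coef], [stable_graded]). The groups permuting the vertices and
    the half-edges act on the labelled stable graphs, and orbit counting turns
    1/(k! m!) times a sum over labelled graphs into the sum over isomorphism
    classes weighted by 1/|Aut| ([sum_stable_graph_reps]). As all vertices are
    stable, 2g - 2 bounds the number of vertices and 3 (2g - 2) the number of
    half-edges, so only finitely many powers of t contribute to each
    coefficient. *)

(** * Finite sums *)

Lemma fsum_ord (R : nmodType) (P : pred nat) (u : nat -> R) N :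
  (forall i, P i -> (N <= i)%N -> u i = 0) ->
  \sum_(i \in [set i | P i]%classic) u i = \sum_(i < N | P i) u i.
Proof.
move=> u0; rewrite (fsbigE [seq i <- iota 0 N | P i]) ?filter_uniq ?iota_uniq //.
- rewrite big_mkcond big_filter /= -big_mkcondr /= -(big_mkord P) /index_iota subn0.
  by apply: eq_bigl => i; case Pi: (P i) => //=; apply/mem_set.
- by move=> i /=; rewrite mem_filter => /andP[].
- move=> i Pi; rewrite mem_filter Pi mem_iota /= add0n -leqNgt; exact: u0.
Qed.

Lemma fsumT_ord (R : nmodType) (u : nat -> R) N :
  (forall i, (N <= i)%N -> u i = 0) ->
  \sum_(i \in [set: nat]%classic) u i = \sum_(i < N) u i.
Proof.
move=> u0; rewrite -(@fsum_ord _ predT u N) => [|i _]; last exact: u0.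
by apply: eq_fsbigl; apply/seteqP; split.
Qed.

Lemma sum_by_card (R : nmodType) (T : finType) (f : nat -> R) :
  \sum_(S : {set T}) f #|S| = \sum_(i < #|T|.+1) f i *+ 'C(#|T|, i).
Proof.
rewrite (partition_big (fun S : {set T} => inord #|S| : 'I_#|T|.+1) predT) //=.
apply: eq_bigr => i _.
have cE (S : {set T}) : (inord #|S| == i) = (#|S| == i).
  by rewrite -val_eqE /= inordK // ltnS max_card.
rewrite (eq_bigl _ _ cE) (eq_bigr (fun=> f i)) => [|S /eqP -> //].
by rewrite sumr_const -card_draws; congr (_ *+ _); apply: eq_card => S; rewrite !inE.
Qed.

Lemma sum_odd0 (R : nmodType) (f : nat -> R) n : (forall i, odd i -> f i = 0) ->
  \sum_(i < (2 * n).+1) f i = \sum_(i < n.+1) f (2 * i)%N.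
Proof.
move=> f0; elim: n => [|n IHn]; first by rewrite !big_ord1.
rewrite mulnS !addSn add0n 2!big_ord_recr IHn [RHS]big_ord_recr /= mulnS.
by rewrite (f0 (2 * n).+1) ?addr0 //= oddM.
Qed.

Lemma sum_antidiag (R : nmodType) (T : nat -> nat -> R) N M : (N <= M)%N ->
  (forall m k, (N <= m + k)%N -> T m k = 0) ->
  \sum_(m < M) \sum_(k < N) T m k = \sum_(n < N) \sum_(k < n.+1) T (n - k)%N k.
Proof.
move=> NM T0; rewrite exchange_big /=.
transitivity (\sum_(n < N) \sum_(k < N | (k <= n)%N) T (n - k)%N k); last first.
  apply: eq_bigr => n _; rewrite -(big_mkord (fun k => k <= n)%N (fun k => T (n - k)%N k)).
  rewrite -(big_mkord xpredT (fun k => T (n - k)%N k)).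
  by rewrite (big_nat_widen _ _ _ xpredT _ (ltn_ord n)); apply: eq_bigl => k.
rewrite [RHS](exchange_big_dep predT) //=; apply: eq_bigr => k _.
rewrite -(big_mkord (fun n => k <= n)%N (fun n => T (n - k)%N k)).
rewrite -(big_mkord xpredT (fun m => T m k)).
rewrite (@big_cat_nat _ _ _ (N - k)) ?leq0n //=; last by rewrite (leq_trans (leq_subr _ _)).
rewrite [X in _ + X]big_nat_cond [X in _ + X]big1 ?addr0; last first.
  by move=> m; rewrite andbT leq_subLR addnC => /andP[+ _]; apply: T0.
rewrite [RHS](@big_cat_nat _ _ _ k) ?leq0n //=; last exact/ltnW.
rewrite [X in _ = X + _]big_nat_cond [X in _ = X + _]big1 ?add0r; last first.
  by move=> n; rewrite leq0n /= ltnNge => /andP[/negP].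
rewrite [RHS](_ : _ = \sum_(0 + k <= i < N | (k <= i)%N) T (i - k)%N k) // big_addn.
by apply: eq_big => i; rewrite ?leq_addl ?addnK.
Qed.

Lemma big_ord_widen0 (f : nat -> rat) n N : (n <= N)%N ->
  (forall i, (n <= i)%N -> f i = 0) -> \sum_(i < n) f i = \sum_(i < N) f i.
Proof.
move=> nN f0; rewrite (big_ord_widen N f nN) big_mkcond; apply: eq_bigr => i _.
by case: ltnP => // /f0.
Qed.

(** * Derivations of a commutative ring *)

Section Leibniz.
Variables (A : nzRingType) (D : A -> A).
Hypothesis DD : forall x y, D (x + y) = D x + D y.
Implicit Types p q : A.

(** The two additivity steps that reduce the Leibniz rule to a spanning set. *)
Lemma leibnizDl p1 p2 q :
  D (p1 * q) = D p1 * q + p1 * D q -> D (p2 * q) = D p2 * q + p2 * D q ->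
  D ((p1 + p2) * q) = D (p1 + p2) * q + (p1 + p2) * D q.
Proof. by move=> E1 E2; rewrite mulrDl !DD E1 E2 !mulrDl addrACA. Qed.

Lemma leibnizDr p q1 q2 :
  D (p * q1) = D p * q1 + p * D q1 -> D (p * q2) = D p * q2 + p * D q2 ->
  D (p * (q1 + q2)) = D p * (q1 + q2) + p * D (q1 + q2).
Proof. by move=> E1 E2; rewrite mulrDr !DD E1 E2 !mulrDr addrACA. Qed.
End Leibniz.

Section Derivation.
Variables (A : comNzRingType) (D : A -> A).
Hypothesis DD : forall x y, D (x + y) = D x + D y.
Hypothesis DM : forall x y, D (x * y) = D x * y + x * D y.

Lemma der0 : D 0 = 0.
Proof. by have /eqP := DD 0 0; rewrite addr0 addrC -subr_eq subrr => /eqP. Qed.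

Lemma derN x : D (- x) = - D x.
Proof. by apply/eqP; rewrite -addr_eq0 -DD addNr der0. Qed.

Lemma derB x y : D (x - y) = D x - D y.
Proof. by rewrite DD derN. Qed.

Lemma derMn x n : D (x *+ n) = D x *+ n.
Proof. by elim: n => [|n IHn]; rewrite ?mulr0n ?der0 // !mulrS DD IHn. Qed.

Lemma der_sum I (r : seq I) (P : pred I) (F : I -> A) :
  D (\sum_(i <- r | P i) F i) = \sum_(i <- r | P i) D (F i).
Proof. exact: (big_morph D DD der0). Qed.

Lemma der1 : D 1 = 0.
Proof. by have /eqP := DM 1 1; rewrite !mulr1 mul1r -subr_eq subrr => /eqP. Qed.

Lemma derX x n : D (x ^+ n.+1) = (x ^+ n * D x) *+ n.+1.
Proof.
elim: n => [|n IHn]; first by rewrite expr0 mul1r.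
by rewrite exprS DM IHn mulrnAr mulrA -exprS [D x * _]mulrC -mulrS.
Qed.

Lemma iter_derD n x y : iter n D (x + y) = iter n D x + iter n D y.
Proof. by elim: n => //= n ->; rewrite DD. Qed.

Lemma iter_derM n x y : iter n D (x * y) =
  \sum_(k < n.+1) (iter (n - k) D x * iter k D y) *+ 'C(n, k).
Proof.
elim: n => [|n IHn]; first by rewrite big_ord1.
pose T i j := iter i D x * iter j D y.
rewrite iterS IHn der_sum.
transitivity (\sum_(k < n.+1) (T (n.+1 - k)%N k *+ 'C(n, k) + T (n - k)%N k.+1 *+ 'C(n, k))).
  apply: eq_bigr => k _; rewrite derMn DM mulrnDl /T subSn ?leq_ord //.
have -> : \sum_(k < n.+2) (iter (n.+1 - k) D x * iter k D y) *+ 'C(n.+1, k) =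
    \sum_(k < n.+2) T (n.+1 - k)%N k *+ 'C(n, k) + \sum_(k < n.+1) T (n - k)%N k.+1 *+ 'C(n, k).
  rewrite big_ord_recl [in RHS]big_ord_recl !bin0 -addrA; congr (_ + _).
  rewrite -big_split; apply: eq_bigr => k _ /=.
  by rewrite /bump /= add1n binS mulrnDr subSS.
by rewrite big_split [in RHS]big_ord_recr /= bin_small // mulr0n addr0.
Qed.

Lemma der_prod k (f : 'I_k -> A) :
  D (\prod_i f i) = \sum_u \prod_i (if i == u then D (f i) else f i).
Proof.
elim: k f => [|k IHk] f; first by rewrite !big_ord0 der1.
rewrite big_ord_recl DM IHk [RHS]big_ord_recl; congr (_ + _).
  by rewrite [RHS]big_ord_recl eqxx.
rewrite big_distrr; apply: eq_bigr => u _ /=; rewrite [RHS]big_ord_recl /=.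
by congr (_ * _); apply: eq_bigr => i _; rewrite (inj_eq lift_inj).
Qed.
End Derivation.

(** * Formal power series *)

Section FpsTheory.
Variable R : comNzRingType.
Implicit Types (f g : fps R) (c : R).

Lemma fps_addE f g a : (f + g) a = f a + g a. Proof. by []. Qed.
Lemma fps_oppE f a : (- f) a = - f a. Proof. by []. Qed.
Lemma fps_subE f g a : (f - g) a = f a - g a. Proof. by []. Qed.
Lemma fps_0E a : (0 : fps R) a = 0. Proof. by []. Qed.
Lemma fps_1E a : (1 : fps R) a = (a == 0%N)%:R. Proof. by case: a. Qed.
Lemma fps_mulE f g a : (f * g) a = \sum_(i < a.+1) f i * g (a - i)%N.
Proof. by []. Qed.
Lemma fps_mul0E f g : (f * g) 0%N = f 0%N * g 0%N.
Proof. by rewrite fps_mulE big_ord1. Qed.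
Lemma fps_sumE I (r : seq I) (P : pred I) (F : I -> fps R) a :
  (\sum_(i <- r | P i) F i) a = \sum_(i <- r | P i) F i a.
Proof. by elim/big_rec2: _ => // i y1 y2 _ <-. Qed.
Lemma fps_mulrnE f n a : (f *+ n) a = f a *+ n.
Proof. by elim: n => [|n IHn]; rewrite ?mulr0n // !mulrS fps_addE IHn. Qed.
Lemma fps_prod0E I (r : seq I) (P : pred I) (F : I -> fps R) :
  (\prod_(i <- r | P i) F i) 0%N = \prod_(i <- r | P i) F i 0%N.
Proof. by elim/big_rec2: _ => // i y1 y2 _ <-; rewrite fps_mul0E. Qed.

Lemma fpsC_mulE c f a : (fpsC c * f) a = c * f a.
Proof.
rewrite fps_mulE big_ord_recl subn0 big1 ?addr0 // => i _.
by rewrite mul0r.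
Qed.

Lemma fpsC_is_zmod_morphism : zmod_morphism (@fpsC R).
Proof. by move=> c d; apply: fpsP => -[|a] //=; rewrite subr0. Qed.
HB.instance Definition _ :=
  GRing.isZmodMorphism.Build R (fps R) (@fpsC R) fpsC_is_zmod_morphism.
Lemma fpsC_is_monoid_morphism : monoid_morphism (@fpsC R).
Proof.
by split=> // c d; apply: fpsP => a; rewrite fpsC_mulE; case: a => //=; rewrite mulr0.
Qed.
HB.instance Definition _ :=
  GRing.isMonoidMorphism.Build R (fps R) (@fpsC R) fpsC_is_monoid_morphism.

(** The coefficients of g in f * g are recovered one after the other, because
    the coefficient f_0 can be cancelled. *)
Lemma fps_lreg f : GRing.lreg (f 0%N) -> GRing.lreg f.
Proof.
move=> reg g h eqfgh; apply: fpsP => n; elim/ltn_ind: n => n IHn.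
have := congr1 (fun u : fps R => u n) eqfgh; rewrite !fps_mulE !big_ord_recl !subn0.
rewrite [X in _ + X = _](eq_bigr (fun i : 'I_n => f (lift ord0 i) * h (n - (lift ord0 i))%N)).
  by move/addIr; apply: reg.
by move=> i _; rewrite IHn //= /bump /= add1n ltn_subrL /= (leq_ltn_trans _ (ltn_ord i)).
Qed.

Definition fps_deriv f : fps R := Fps (fun a => f a.+1 *+ a.+1).

(** In the coefficient of degree a, the factor a + 1 splits as i + (a + 1 - i)
    over the two factors. *)
Lemma fps_derivM f g : fps_deriv (f * g) = fps_deriv f * g + f * fps_deriv g.
Proof.
apply: fpsP => a; rewrite fps_addE [fps_deriv (f * g) a]/=.
rewrite -sumrMnl.
transitivity (\sum_(i < a.+2) ((f i *+ i) * g (a.+1 - i)%N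
    + f i * (g (a.+1 - i)%N *+ (a.+1 - i)))).
  apply: eq_bigr => i _; rewrite mulrnAl mulrnAr -mulrnDr subnKC //.
  exact: leq_ord.
rewrite big_split /=; congr (_ + _).
  by rewrite big_ord_recl mulr0n mul0r add0r.
rewrite big_ord_recr /= subnn mulr0n mulr0 addr0.
by apply: eq_bigr => i _; rewrite subSn // leq_ord.
Qed.
End FpsTheory.

Definition fps_map (R S : Type) (D : R -> S) (f : fps R) : fps S := Fps (fun a => D (f a)).

Lemma fps_map_deriv (R : comNzRingType) (D : R -> R) :
  (forall p q, D (p + q) = D p + D q) ->
  (forall p q, D (p * q) = D p * q + p * D q) ->
  forall f g : fps R, fps_map D (f * g) = fps_map D f * g + f * fps_map D g.
Proof.
move=> DD DM f g; apply: fpsP => a.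
rewrite fps_addE !fps_mulE [LHS](der_sum DD) -big_split /=.
by apply: eq_bigr => i _; rewrite DM.
Qed.

(** * Connected graphs *)

Section Connectivity.
Variables V H : finType.
Implicit Type G : wgraph V H.

Lemma adj_sym G : involutive (hopp G) -> symmetric (adj G).
Proof.
move=> oK u v; apply/existsP/existsP=> -[x /andP[/eqP <- /eqP <-]];
  by exists (hopp G x); rewrite oK !eqxx.
Qed.

(** Connectedness is tested from any chosen vertex; without a vertex the number
    of components is zero. *)
Lemma ncomp1P G (v : V) : involutive (hopp G) ->
  reflect (forall u, connect (adj G) v u) (ncomp G == 1%N).
Proof.
move=> oK; have sG := sym_connect_sym (adj_sym oK).
apply: (iffP idP) => [/eqP|cG].
  rewrite /ncomp /n_comp_mem => /eqP/card1P [r Er] u.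
  have rr w : fingraph.root (adj G) w = r.
    by apply/eqP; have := Er (fingraph.root (adj G) w); rewrite !inE roots_root // => <-.
  by rewrite -(root_connect sG) !rr.
by rewrite -[ncomp G](eq_n_comp_r (a := connect (adj G) v)) ?n_comp_connect // => u;
  rewrite !inE; apply/esym/cG.
Qed.

Lemma att_connect G h : connect (adj G) (att G h) (att G (hopp G h)).
Proof. by apply: connect1; apply/existsP; exists h; rewrite !eqxx. Qed.

End Connectivity.

(** The genera are set to 0: connectivity is a matter of the attaching map and
    the matching alone. *)
Definition bare (V H : finType) (a : H -> V) (o : H -> H) : wgraph V H :=
  WGraph a o (fun=> 0%N).

Definition fpf_inv (H : finType) (o : {ffun H -> H}) :=
  [forall h, (o h != h) && (o (o h) == h)].

Lemma fpf_invP (H : finType) (o : {ffun H -> H}) :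
  reflect ((forall h, o h != h) /\ involutive o) (fpf_inv o).
Proof.
apply: (iffP forallP) => [fo|[o1 oK] h]; last by rewrite o1 oK eqxx.
by split=> h; case/andP: (fo h) => // _ /eqP.
Qed.

(** * Splitting a graph along a component *)

Section Glue.
Variables X X1 X2 Y Y1 Y2 : finType.
Variables (fX : X -> X1 + X2) (gX : X1 + X2 -> X).
Variables (fY : Y -> Y1 + Y2) (gY : Y1 + Y2 -> Y).
Hypotheses (fXK : cancel fX gX) (gXK : cancel gX fX).
Hypotheses (fYK : cancel fY gY) (gYK : cancel gY fY).

Definition isl (A B : Type) (s : A + B) := if s is inl _ then true else false.

(** The bijections f and g present X and Y as disjoint unions, in which two
    functions can be put side by side. *)
Definition splice (p : {ffun X1 -> Y1} * {ffun X2 -> Y2}) : {ffun X -> Y} :=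
  [ffun x => gY (match fX x with inl u => inl (p.1 u) | inr u => inr (p.2 u) end)].

Lemma splice_inl p u : splice p (gX (inl u)) = gY (inl (p.1 u)).
Proof. by rewrite ffunE gXK. Qed.

Lemma splice_inr p u : splice p (gX (inr u)) = gY (inr (p.2 u)).
Proof. by rewrite ffunE gXK. Qed.

Definition respects (f : {ffun X -> Y}) := [forall x, isl (fY (f x)) == isl (fX x)].

(** A function that respects the two decompositions is the same thing as a pair
    of functions between the corresponding parts. *)
Lemma sum_splice (R : nmodType) (w : {ffun X -> Y} -> R) :
  \sum_(f | respects f) w f = \sum_f1 \sum_f2 w (splice (f1, f2)).
Proof.
rewrite pair_big /=.
have splice_inj : injective splice.
  move=> [f1 f2] [f1' f2'] /ffunP eqf; congr pair; apply/ffunP => u.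
    by have := eqf (gX (inl u)); rewrite !splice_inl => /(can_inj gYK) [].
  by have := eqf (gX (inr u)); rewrite !splice_inr => /(can_inj gYK) [].
transitivity (\sum_p w (splice p)); last by apply: eq_bigr => -[].
rewrite -[RHS](big_imset w (h := splice) (A := predT)) /=; last first.
  by move=> p q _ _; apply: splice_inj.
apply: eq_bigl => f; apply/idP/imsetP => [/forallP rf|[p _ ->]]; last first.
  by apply/forallP => x; rewrite ffunE gYK; case: (fX x).
have /fin_all_exists [f1 f1E] u : exists y, f (gX (inl u)) = gY (inl y).
  have := rf (gX (inl u)); rewrite gXK; case E: (fY _) => [y|//] _.
  by exists y; rewrite -E fYK.
have /fin_all_exists [f2 f2E] u : exists y, f (gX (inr u)) = gY (inr y).
  have := rf (gX (inr u)); rewrite gXK; case E: (fY _) => [//|y] _.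
  by exists y; rewrite -E fYK.
exists (finfun f1, finfun f2) => //; apply/ffunP => x; rewrite ffunE -[in LHS](fXK x).
by case: (fX x) => u; rewrite /= ffunE ?f1E ?f2E.
Qed.

End Glue.

Lemma set_split (T : finType) (S : {set T}) :
  exists f : T -> 'I_#|S| + 'I_#|~: S|, exists g : 'I_#|S| + 'I_#|~: S| -> T,
    [/\ cancel f g, cancel g f & forall x, isl (f x) = (x \in S)].
Proof.
pose g (s : 'I_#|S| + 'I_#|~: S|) := match s with inl i => enum_val i | inr j => enum_val j end.
have gS s : (g s \in S) = isl s.
  case: s => i /=; first by rewrite enum_valP.
  by apply/negbTE; have := enum_valP i; rewrite inE.
have g_inj : injective g.
  move=> s t gst; have := gS s; rewrite gst gS.
  by case: s t gst => [i|i] [j|j] // /enum_val_inj ->.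
have [|f gK fK] := @inj_card_bij _ _ g g_inj; first by rewrite card_sum !card_ord cardsC.
by exists f, g; split=> // x; rewrite -[in RHS](fK x) gS.
Qed.

Section GraphSums.
Variables (R : comNzRingType) (x : nat -> R).

Definition val_weight (V H : finType) (a : H -> V) : R :=
  \prod_v x #|[set h | a h == v]|.

(** The sum over all graphs without external edges on the given labelled
    vertices and half-edges: the attaching map a and the matching o of the
    half-edges are arbitrary, and a vertex of valence n has weight x n. *)
Definition graph_sum (V H : finType) : R :=
  \sum_(a : {ffun H -> V}) \sum_(o : {ffun H -> H} | fpf_inv o) val_weight a.

Definition conn_sum (V H : finType) : R :=
  \sum_(a : {ffun H -> V})
    \sum_(o : {ffun H -> H} | fpf_inv o && (ncomp (bare a o) == 1%N)) val_weight a.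

Section SplitGraph.
Variables V V1 V2 H H1 H2 : finType.
Variables (fV : V -> V1 + V2) (gV : V1 + V2 -> V).
Variables (fH : H -> H1 + H2) (gH : H1 + H2 -> H).
Hypotheses (fVK : cancel fV gV) (gVK : cancel gV fV).
Hypotheses (fHK : cancel fH gH) (gHK : cancel gH fH).
Variables (S : {set V}) (T : {set H}).
Hypotheses (fS : forall v, isl (fV v) = (v \in S)) (fT : forall h, isl (fH h) = (h \in T)).

Local Notation glA := (splice fH gV).
Local Notation glO := (splice fH gH).

Lemma fpf_splice o1 o2 : fpf_inv (glO (o1, o2)) = fpf_inv o1 && fpf_inv o2.
Proof.
have gK := can_inj gHK; have fK := can_inj fHK.
apply/forallP/andP => [fo|[/forallP fo1 /forallP fo2] h].
  split; apply/forallP => u.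
    have := fo (gH (inl u)); rewrite !splice_inl //= !(inj_eq gK).
    by rewrite !(inj_eq (@inl_inj _ _)).
  have := fo (gH (inr u)); rewrite !splice_inr //= !(inj_eq gK).
  by rewrite !(inj_eq (@inr_inj _ _)).
rewrite -(fHK h); case: (fH h) => u.
  by rewrite !splice_inl //= !(inj_eq gK) !(inj_eq (@inl_inj _ _)).
by rewrite !splice_inr //= !(inj_eq gK) !(inj_eq (@inr_inj _ _)).
Qed.

Lemma weight_splice a1 a2 :
  val_weight (glA (a1, a2)) = val_weight a1 * val_weight a2.
Proof.
have gK := can_inj gVK.
rewrite /val_weight (reindex gV) /=; last by exists fV => ? _; rewrite ?fVK ?gVK.
rewrite big_sumType /=; congr (_ * _); apply: eq_bigr => v _; congr (x _).
  rewrite -(card_imset _ (inj_comp (can_inj gHK) (@inl_inj _ _))).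
  apply: eq_card => h; apply/idP/imsetP => [|[u]]; rewrite !inE; last first.
    by move=> /eqP <- ->; rewrite /= splice_inl.
  rewrite -(fHK h); case: (fH h) => u; rewrite ?splice_inl ?splice_inr //= (inj_eq gK) //.
  by rewrite (inj_eq (@inl_inj _ _)) => au; exists u; rewrite ?inE.
rewrite -(card_imset _ (inj_comp (can_inj gHK) (@inr_inj _ _))).
apply: eq_card => h; apply/idP/imsetP => [|[u]]; rewrite !inE; last first.
  by move=> /eqP <- ->; rewrite /= splice_inr.
rewrite -(fHK h); case: (fH h) => u; rewrite ?splice_inl ?splice_inr //= (inj_eq gK) //.
by rewrite (inj_eq (@inr_inj _ _)) => au; exists u; rewrite ?inE.
Qed.

(** No edge leaves the first part, so a path that starts there stays there and
    is a path of the first graph. *)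
Lemma connect_splice a1 a2 o1 o2 u w :
  connect (adj (bare (glA (a1, a2)) (glO (o1, o2)))) (gV (inl u)) w =
  [exists w', (w == gV (inl w')) && connect (adj (bare a1 o1)) u w'].
Proof.
set e := adj _; set e1 := adj _; have gK := can_inj gVK.
have e_l v w' : e (gV (inl v)) w' = [exists v', (w' == gV (inl v')) && e1 v v'].
  apply/existsP/existsP => [[h]|[v' /andP[/eqP -> /existsP[h /andP[/eqP <- /eqP <-]]]]].
    rewrite /= -(fHK h); case: (fH h) => h'; rewrite ?splice_inl ?splice_inr //=.
      rewrite (inj_eq gK) (inj_eq (@inl_inj _ _)) => /andP[/eqP <- /eqP <-].
      exists (a1 (o1 h')); rewrite eqxx; apply/existsP; exists h'.
      by rewrite /= !eqxx.
    by rewrite (inj_eq gK).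
  by exists (gH (inl h)); rewrite /= !splice_inl //= !eqxx.
apply/idP/existsP => [/connectP[p]|[w' /andP[/eqP-> /connectP[p]]]].
  elim: p u => [|v p IHp] u /=; first by move=> _ ->; exists u; rewrite eqxx connect0.
  rewrite e_l => /andP[/existsP[v' /andP[/eqP -> uv']] pth] wE.
  have [w' /andP[/eqP wE' v'w']] := IHp _ pth wE.
  by exists w'; rewrite wE' eqxx (connect_trans (connect1 uv') v'w').
elim: p u => [|v p IHp] u /=; first by move=> _ ->.
move=> /andP[uv pth] /(IHp _ pth); apply: connect_trans; apply: connect1.
by rewrite e_l; apply/existsP; exists v; rewrite eqxx.
Qed.

Definition marked_comp (h0 : H) (a : {ffun H -> V}) (o : {ffun H -> H}) : bool :=
  (S == [set v | connect (adj (bare a o)) (a h0) v]) && (T == [set h | a h \in S]).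

(** Since h0 lies in the first part, which is closed under adjacency, this part
    is the component of h0 as soon as it is connected. *)
Lemma marked_comp_splice h0 a1 a2 o1 o2 : h0 \in T -> fpf_inv o1 ->
  marked_comp h0 (glA (a1, a2)) (glO (o1, o2)) = (ncomp (bare a1 o1) == 1%N).
Proof.
move=> h0T /fpf_invP[_ oK].
have [u0 h0E] : exists u0, h0 = gH (inl u0).
  by have := fT h0; rewrite h0T; case E: (fH h0) => [u|] // _; exists u; rewrite -E fHK.
have -> : (ncomp (bare a1 o1) == 1%N) = [forall u, connect (adj (bare a1 o1)) (a1 u0) u].
  by apply/(@ncomp1P _ _ (bare a1 o1) (a1 u0) oK)/forallP.
have TE : T = [set h | glA (a1, a2) h \in S].
  apply/setP => h; rewrite inE -fT -fS -(fHK h).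
  by case: (fH h) => u; rewrite ?splice_inl ?splice_inr //= gHK gVK.
rewrite /marked_comp {1}TE eqxx andbT h0E splice_inl //.
apply/eqP/forallP => [SE u|cG].
  have : gV (inl u) \in S by rewrite -fS gVK.
  rewrite SE inE connect_splice => /existsP[w /andP[]].
  by rewrite (inj_eq (can_inj gVK)) (inj_eq (@inl_inj _ _)) => /eqP ->.
apply/setP => v; rewrite -fS inE connect_splice -(fVK v).
apply/idP/existsP => [|[w /andP[/eqP -> _]]]; last by rewrite !gVK.
by case: (fV v) => u; rewrite gVK // => _; exists u; rewrite eqxx cG.
Qed.

Lemma marked_comp_respects h0 a o : fpf_inv o -> marked_comp h0 a o ->
  respects fH fV a && respects fH fH o.
Proof.
move=> /fpf_invP[_ oK] /andP[/eqP SE /eqP TE].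
apply/andP; split; apply/forallP => h; apply/eqP.
  by rewrite fS fT TE inE.
have sG : connect_sym (adj (bare a o)) by apply/sym_connect_sym/adj_sym.
rewrite !fT TE !inE SE !inE; apply/esym.
exact: (same_connect_r sG (att_connect (bare a o) h)).
Qed.

(** A graph in which h0 has the component (S, T) is a connected graph on (S, T)
    next to an arbitrary graph on the complements. *)
Lemma sum_marked_comp h0 : h0 \in T ->
  \sum_(a : {ffun H -> V}) \sum_(o : {ffun H -> H} | fpf_inv o && marked_comp h0 a o)
    val_weight a = conn_sum V1 H1 * graph_sum V2 H2.
Proof.
move=> h0T.
rewrite (bigID (respects fH fV)) /= [X in _ + X]big1 ?addr0 => [|a nr]; last first.
  rewrite big1 // => o /andP[fo mo].
  by have := marked_comp_respects fo mo; rewrite (negPf nr).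
transitivity (\sum_(a : {ffun H -> V} | respects fH fV a)
    \sum_(o : {ffun H -> H} | respects fH fH o)
    if fpf_inv o && marked_comp h0 a o then val_weight a else 0).
  apply: eq_bigr => a _; rewrite -big_mkcondr; apply: eq_bigl => o.
  case: (boolP (respects fH fH o)) => //=; rewrite ?andbT ?andbF //.
  move=> nr; apply/negbTE/negP => /andP[fo mo].
  by have := marked_comp_respects fo mo; rewrite (negPf nr) andbF.
rewrite (sum_splice fHK gHK fVK gVK).
under eq_bigr do under eq_bigr do rewrite (sum_splice fHK gHK fHK gHK).
rewrite /conn_sum /graph_sum big_distrl /=; apply: eq_bigr => a1 _.
rewrite big_distrr /=; apply: eq_bigr => a2 _.
rewrite big_distrl /= [RHS]big_mkcond /=; apply: eq_bigr => o1 _.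
rewrite [in RHS]big_mkcond; case: ifP => /= [/andP[fo1 c1]|n1]; last first.
  rewrite big1 // => o2 _; rewrite fpf_splice; case: (boolP (fpf_inv o1)) => //= fo1.
  by rewrite marked_comp_splice //; move: n1; rewrite fo1 => /= ->; rewrite andbF.
rewrite big_distrr /=; apply: eq_bigr => o2 _.
by rewrite fpf_splice marked_comp_splice // fo1 c1 andbT /=; case: ifP; rewrite ?mulr0 ?weight_splice.
Qed.

End SplitGraph.

(** Every half-edge h0 is marked in turn and the graphs are sorted by the
    component of h0; a given pair (S, T) then occurs once for each h0 in T.
    Marking half-edges rather than vertices produces the operator t d/dt, and
    isolated vertices need no separate treatment. *)
Lemma sum_by_component (V H : finType) :
  #|H|%:R * graph_sum V H = \sum_(S : {set V}) \sum_(T : {set H})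
    #|T|%:R * (conn_sum 'I_#|S| 'I_#|T| * graph_sum 'I_#|~: S| 'I_#|~: T|).
Proof.
(* For a fixed h0, each graph is counted in the pair (S, T) of its component. *)
have part h0 : graph_sum V H = \sum_(S : {set V}) \sum_(T : {set H} | h0 \in T)
     (conn_sum 'I_#|S| 'I_#|T| * graph_sum 'I_#|~: S| 'I_#|~: T|).
  transitivity (\sum_(S : {set V}) \sum_(T : {set H}) \sum_(a : {ffun H -> V})
     \sum_(o : {ffun H -> H} | fpf_inv o && marked_comp S T h0 a o) val_weight a).
    rewrite /graph_sum; under [RHS]eq_bigr do rewrite exchange_big /=.
    rewrite [RHS]exchange_big /=; apply: eq_bigr => a _.
    under [RHS]eq_bigr do under eq_bigr do rewrite big_mkcondr /=.
    under [RHS]eq_bigr do rewrite exchange_big /=.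
    rewrite [RHS]exchange_big /=; apply: eq_bigr => o _.
    set S0 := [set v | connect (adj (bare a o)) (a h0) v].
    rewrite (bigD1 S0) //= [X in _ + X]big1 ?addr0 => [|S nS]; last first.
      by apply: big1 => T _; rewrite /marked_comp (negPf nS).
    rewrite (bigD1 [set h | a h \in S0]) //= [X in _ + X]big1 ?addr0 => [|T nT].
      by rewrite /marked_comp !eqxx.
    by rewrite /marked_comp (negPf nT) andbF.
  apply: eq_bigr => S _; rewrite [RHS]big_mkcond; apply: eq_bigr => T _.
  have [fV [gV [fVK gVK fS]]] := set_split S.
  have [fH [gH [fHK gHK fT]]] := set_split T.
  case: ifP => h0T; first exact: (sum_marked_comp fVK gVK fHK gHK fS fT).
  rewrite big1 // => a _; rewrite big1 // => o /andP[_ /andP[/eqP SE /eqP TE]].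
  by rewrite TE inE SE inE connect0 in h0T.
transitivity (\sum_(h0 : H) graph_sum V H).
  by rewrite sumr_const mulr_natl.
under eq_bigr => h0 _ do rewrite (part h0).
rewrite exchange_big; apply: eq_bigr => S _ /=.
rewrite (exchange_big_dep predT) //=; apply: eq_bigr => T _.
by rewrite sumr_const mulr_natl.
Qed.

End GraphSums.

(** * The exponential formula *)

(** With fewer half-edges than vertices, some vertex has valence 0. *)
Lemma val_weight_small (R : comNzRingType) (x : nat -> R) k m (a : 'I_m -> 'I_k) :
  x 0 = 0 -> (m < k)%N -> val_weight x a = 0.
Proof.
move=> x0 lt_mk; case: (pickP (fun v => v \notin codom a)) => [v nv|sur].
  rewrite /val_weight (bigD1 v) //= (_ : #|_| = 0%N) ?x0 ?mul0r //.
  apply: eq_card0 => h; rewrite !inE; apply: contraNF nv => /eqP <-.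
  exact: codom_f.
have := leq_image_card a predT; rewrite (eq_card (B := predT)) ?cardT ?size_enum_ord.
  by rewrite leqNgt lt_mk.
by move=> v; have := sur v; case: (boolP (v \in codom a)).
Qed.

Section ExponentialFormula.
Variables (R : comAlgType rat) (x : nat -> R).

Definition graph_coef (k m : nat) : R := (k`! * m`!)%:R^-1 *: graph_sum x 'I_k 'I_m.
Definition conn_coef (k m : nat) : R := (k`! * m`!)%:R^-1 *: conn_sum x 'I_k 'I_m.

(** The summands of [sum_by_component] depend only on the cardinals of S and T;
    the binomial coefficients that count these sets turn the sum into a
    convolution of exponential generating functions. *)
Lemma marked_exp_formula k m :
  m%:R * graph_coef k m = \sum_(j < m.+1) \sum_(i < k.+1)
    j%:R * (conn_coef i j * graph_coef (k - i) (m - j)).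
Proof.
have fact0 n : n`!%:R != 0 :> rat by rewrite pnatr_eq0 -lt0n fact_gt0.
rewrite /graph_coef -scalerAr -[m in m%:R * _]card_ord sum_by_component.
transitivity ((k`! * m`!)%:R^-1 *: \sum_(S : {set 'I_k}) \sum_(T : {set 'I_m})
    #|T|%:R * (conn_sum x 'I_#|S| 'I_#|T| * graph_sum x 'I_(k - #|S|) 'I_(m - #|T|))).
  congr (_ *: _); apply: eq_bigr => S _; apply: eq_bigr => T _.
  have cC n (U : {set 'I_n}) : #|~: U| = (n - #|U|)%N by rewrite cardsCs setCK card_ord.
  by rewrite !cC.
pose f i j := j%:R * (conn_sum x 'I_i 'I_j * graph_sum x 'I_(k - i) 'I_(m - j)).
rewrite (eq_bigr (fun S : {set 'I_k} => \sum_(j < m.+1) f #|S| j *+ 'C(m, j))); last first.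
  by move=> S _; rewrite (sum_by_card _ (f #|S|)) card_ord.
rewrite exchange_big scaler_sumr; apply: eq_bigr => j _ /=.
rewrite (sum_by_card _ (fun i => f i j *+ 'C(m, j))) card_ord scaler_sumr.
apply: eq_bigr => i _; rewrite /conn_coef /f -scalerAl -scalerAr -!scalerAr scalerA.
rewrite -mulrnA -scaler_nat scalerA; congr (_ *: _).
have le_ik : (i <= k)%N := leq_ord i; have le_jm : (j <= m)%N := leq_ord j.
rewrite -(bin_fact le_ik) -(bin_fact le_jm) !natrM.
have Cn0 n (l : 'I_n.+1) : 'C(n, l)%:R != 0 :> rat.
  by rewrite pnatr_eq0 -lt0n bin_gt0 leq_ord.
have := (Cn0 k i, Cn0 m j, fact0 i, fact0 j, fact0 (k - i)%N, fact0 (m - j)%N).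
case=> -[[[[h1 h2] h3] h4] h5] h6.
by field; rewrite h1 h2 h3 h4 h5 h6.
Qed.

Lemma fpf_inv_even (H : finType) (o : {ffun H -> H}) : fpf_inv o -> ~~ odd #|H|.
Proof.
move=> /fpf_invP[o1 oK].
rewrite (@card_edges _ _ (bare id o) oK) (_ : external _ = set0) ?cards0 ?oddM //.
by apply/setP => h; rewrite !inE (negPf (o1 h)).
Qed.

Lemma conn_sum_odd k m : odd m -> conn_sum x 'I_k 'I_m = 0.
Proof.
move=> om; apply: big1 => a _; apply: big1 => o /andP[/fpf_inv_even].
by rewrite card_ord om.
Qed.

Hypothesis x0 : x 0 = 0.

Lemma graph_coef_small k m : (m < k)%N -> graph_coef k m = 0.
Proof.
move=> lt; rewrite /graph_coef /graph_sum big1 ?scaler0 // => a _.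
by apply: big1 => o _; rewrite val_weight_small.
Qed.

Lemma conn_coef_small k m : (m < k)%N -> conn_coef k m = 0.
Proof.
move=> lt; rewrite /conn_coef /conn_sum big1 ?scaler0 // => a _.
by apply: big1 => o _; rewrite val_weight_small.
Qed.

(** When isolated vertices have weight 0, at most m vertices can carry m
    half-edges and the sum over the number of vertices is finite. *)
Definition graph_total m : R := \sum_(k < m.+1) graph_coef k m.
Definition conn_total m : R := \sum_(k < m.+1) conn_coef k m.

(** The generating polynomials in a variable marking the vertices satisfy the
    convolution identity by [marked_exp_formula]; they are evaluated at 1. *)
Lemma exp_formula m :
  m%:R * graph_total m = \sum_(j < m.+1) j%:R * (conn_total j * graph_total (m - j)).
Proof.
pose A n := \poly_(k < n.+1) graph_coef k n.
pose C n := \poly_(k < n.+1) conn_coef k n.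
have AE n : graph_total n = (A n).[1].
  by rewrite horner_poly; apply: eq_bigr => k _; rewrite expr1n mulr1.
have CE n : conn_total n = (C n).[1].
  by rewrite horner_poly; apply: eq_bigr => k _; rewrite expr1n mulr1.
have Ak n k : (A n)`_k = graph_coef k n.
  by rewrite coef_poly; case: ltnP => // ?; rewrite graph_coef_small.
have Ck n k : (C n)`_k = conn_coef k n.
  by rewrite coef_poly; case: ltnP => // ?; rewrite conn_coef_small.
have E : m%:R *: A m = \sum_(j < m.+1) j%:R *: (C j * A (m - j)%N).
  apply/polyP => k; rewrite coefZ Ak marked_exp_formula coef_sum.
  apply: eq_bigr => j _; rewrite coefZ coefM big_distrr /=.
  by apply: eq_bigr => i _; rewrite Ak Ck.
have := congr1 (fun p => p.[1]) E; rewrite hornerZ -AE horner_sum => ->.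
by apply: eq_bigr => j _; rewrite hornerZ hornerM -AE -CE.
Qed.

Lemma conn_total_odd m : odd m -> conn_total m = 0.
Proof. by move=> om; apply: big1 => k _; rewrite /conn_coef conn_sum_odd ?scaler0. Qed.

End ExponentialFormula.

Section EvenExponentialFormula.
Variables (R : comAlgType rat) (x : nat -> R).
Hypothesis x0 : x 0 = 0.

Lemma even_exp_formula e :
  e%:R * graph_total x (2 * e) =
  \sum_(j < e.+1) j%:R * (conn_total x (2 * j) * graph_total x (2 * (e - j))).
Proof.
apply: (@scalerI rat R 2%:R) => //.
rewrite !scaler_nat -mulrnAl -mulrnA (mulnC e) (exp_formula x0).
rewrite (sum_odd0 (f := fun j => j%:R * (conn_total x j * graph_total x (2 * e - j)))) => [|j oj].
  rewrite -sumrMnl; apply: eq_bigr => j _.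
  by rewrite mulnBr -mulrnAl -mulrnA (mulnC j).
by rewrite conn_total_odd // mul0r mulr0.
Qed.

End EvenExponentialFormula.

(** * Fixed-point-free involutions *)

Definition num_fpf (n : nat) : nat := #|[set o : {ffun 'I_n -> 'I_n} | fpf_inv o]|.

Lemma num_fpf0 : num_fpf 0 = 1%N.
Proof.
apply/eqP/cards1P; exists [ffun i : 'I_0 => i]; apply/setP => o; rewrite !inE.
by transitivity true; [apply/fpf_invP; split; case | apply/esym/eqP/ffunP; case].
Qed.

Lemma num_fpf2 : num_fpf 2 = 1%N.
Proof.
apply/eqP/cards1P; exists [ffun i : 'I_2 => rev_ord i]; apply/setP => o; rewrite !inE.
apply/fpf_invP/eqP => [[o1 _]|->]; last first.
  by split=> i; rewrite !ffunE ?rev_ordK // -val_eqE /=; case: i => [[|[]]].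
apply/ffunP => i; rewrite ffunE; apply: val_inj => /=.
have := o1 i; rewrite -val_eqE /=.
by case: (o i) => -[|[]] // ?; case: i => -[|[]].
Qed.

(** The partner h1 of the first point is chosen among n + 1 points; what remains
    is an involution of the complement of these two points. *)
Lemma num_fpf_rec n : num_fpf n.+2 = (n.+1 * num_fpf n)%N.
Proof.
rewrite /num_fpf -sum1_card (eq_bigl (@fpf_inv _)) => [|o]; last by rewrite inE.
rewrite (partition_big (fun o : {ffun 'I_n.+2 -> 'I_n.+2} => o ord0) (predC1 ord0)) /=;
  last by move=> o /fpf_invP[].
transitivity (\sum_(h1 : 'I_n.+2 | h1 != ord0) num_fpf n)%N; last first.
  by rewrite sum_nat_const cardC1 card_ord.
apply: eq_bigr => h1 h10; pose T := [set ord0; h1].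
have [f [g [fK gK fT]]] := set_split T.
have cT : #|T| = 2 by rewrite cards2 eq_sym h10.
have cT' : #|~: T| = n by rewrite cardsCs setCK cT card_ord subn2.
(* o maps {ord0, h1} to itself exactly when it exchanges its two elements. *)
have op1 (o : {ffun 'I_n.+2 -> 'I_n.+2}) : fpf_inv o ->
    (o ord0 == h1) = respects f f o.
  move=> /fpf_invP[o1 oK]; apply/eqP/forallP => [oh0 h|/(_ ord0)].
    by rewrite !fT !inE -oh0 (can2_eq oK oK) (can_eq oK) orbC eqxx.
  by rewrite !fT !inE eqxx /= (negPf (o1 _)) => /eqP/eqP.
transitivity (\sum_(o : {ffun 'I_n.+2 -> 'I_n.+2} | respects f f o) fpf_inv o : nat)%N.
  rewrite [RHS]big_mkcond [LHS]big_mkcond; apply: eq_bigr => o _.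
  by case: (boolP (fpf_inv o)) => /= [/op1 ->|_]; [case: (respects _ _ _) | rewrite if_same].
rewrite (sum_splice fK gK fK gK) pair_big /=.
under eq_bigr do rewrite (fpf_splice fK gK).
transitivity (num_fpf #|T| * num_fpf #|~: T|)%N; last by rewrite cT cT' num_fpf2 mul1n.
rewrite /num_fpf -!sum1_card big_distrlr /= pair_big /= [RHS]big_mkcond /=.
by apply: eq_bigr => -[o1 o2] _ /=; rewrite !inE; case: (_ && _).
Qed.

Lemma num_fpfE e : (num_fpf (2 * e) * (2 ^ e * e`!))%N = (2 * e)`!.
Proof.
elim: e => [|e IHe]; first by rewrite num_fpf0.
rewrite mulnS !addSn add0n num_fpf_rec !factS expnS.
by rewrite -IHe; move: (num_fpf _) (2 ^ e)%N (e`!) => a b c; lia.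
Qed.

Lemma graph_sum_fpf (R : comNzRingType) (x : nat -> R) k m :
  graph_sum x 'I_k 'I_m = (\sum_(a : {ffun 'I_m -> 'I_k}) val_weight x a) *+ num_fpf m.
Proof.
rewrite /graph_sum -sumrMnl; apply: eq_bigr => a _; rewrite sumr_const.
by congr (_ *+ _); apply: eq_card => o; rewrite !inE.
Qed.

Lemma graph_coef_even (R : comAlgType rat) (x : nat -> R) k e :
  graph_coef x k (2 * e) =
  (2 ^ e * e`!)%:R^-1 *: (k`!%:R^-1 *: \sum_(a : {ffun 'I_(2 * e) -> 'I_k}) val_weight x a).
Proof.
rewrite /graph_coef graph_sum_fpf -scaler_nat !scalerA; congr (_ *: _).
have := fact_gt0 (2 * e); rewrite -num_fpfE muln_gt0 => /andP[n0 f0].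
rewrite !natrM.
have h1 : (num_fpf (2 * e))%:R != 0 :> rat by rewrite pnatr_eq0 -lt0n.
have h2 : k`!%:R != 0 :> rat by rewrite pnatr_eq0 -lt0n fact_gt0.
have h3 : e`!%:R != 0 :> rat by rewrite pnatr_eq0 -lt0n fact_gt0.
have h4 : (2 ^ e)%:R != 0 :> rat by rewrite pnatr_eq0 -lt0n expn_gt0.
by field; rewrite h1 h2 h3 h4.
Qed.

(** * Vector fields in infinitely many variables *)

(** All that the argument needs to know of rat[V_1, V_2, ...] are its variables
    and its partial derivatives, so P is any algebra that has them. *)
Section DerivV.
Variables (P : comAlgType rat) (dP : nat -> P -> P) (xP : nat -> P).
Hypothesis dPD : forall i p q, dP i (p + q) = dP i p + dP i q.
Hypothesis dPM : forall i p q, dP i (p * q) = dP i p * q + p * dP i q.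
Hypothesis dP1 : forall i c, dP i c%:A = 0.
Hypothesis dPx : forall i j, dP i (xP j) = (i == j)%:R.
Hypothesis dP_eventually0 : forall p, exists N, forall i, (N <= i)%N -> dP i p = 0.

Local Notation E := (fps P).
Implicit Types (f g : E).

(** The variables V_1, V_2, ... of P, completed by V_0 = 0: these are the
    constant coefficients, as power series in V_0, of the variables [evar n]. *)
Definition pvar n : P := if n is i.+1 then xP i else 0.
Definition evar n : E := if n is i.+1 then fpsC (xP i) else fpsX P.
Definition dE n f : E := if n is i.+1 then fps_map (dP i) f else fps_deriv f.

Lemma dP0 i : dP i 0 = 0.
Proof. by rewrite -[X in dP i X](scale0r 1) dP1. Qed.

Lemma dED n f g : dE n (f + g) = dE n f + dE n g.
Proof.
apply: fpsP => a; case: n => [|n]; rewrite fps_addE /=; first by rewrite mulrnDl.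
exact: dPD.
Qed.

Lemma dEM n f g : dE n (f * g) = dE n f * g + f * dE n g.
Proof.
case: n => [|n]; first exact: fps_derivM.
exact: (fps_map_deriv (dPD n) (dPM n)).
Qed.

Lemma dEC n (c : rat) : dE n (fpsC c%:A) = 0.
Proof.
apply: fpsP => a; case: n => [|n] /=; first by rewrite mul0rn.
by case: a => [|a]; rewrite ?dP1 ?dP0.
Qed.

Lemma dE_evar n m : dE n (evar m) = (n == m)%:R.
Proof.
have nE (b : bool) a : (b%:R : E) a = (b && (a == 0%N))%:R by case: b => //; apply: fps_1E.
apply: fpsP => a; rewrite nE; case: n m => [|n] [|m] /=.
- by rewrite eqSS; case: eqP => [->|_]; rewrite ?mulr1n ?mul0rn.
- by rewrite mul0rn.
- by case: eqP => _; rewrite ?dP0 // -(scale1r 1) dP1.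
- by rewrite eqSS; case: a => [|a] /=; rewrite ?dP0 ?andbF ?dPx ?andbT.
Qed.

Lemma dE_eventually0 f a :
  exists N, forall n i, (N <= n)%N -> (i <= a)%N -> dE n f i = 0.
Proof.
elim: a => [|a [N fN]].
  have [N fN] := dP_eventually0 (f 0%N).
  by exists N.+1 => -[//|n] i Nn; rewrite leqn0 => /eqP ->; apply: fN.
have [M fM] := dP_eventually0 (f a.+1).
exists (maxn N M).+1 => -[//|n] i; rewrite ltnS geq_max => /andP[Nn Mn].
rewrite leq_eqVlt => /predU1P[->|]; first exact: fM.
by rewrite ltnS => ia; apply: fN; rewrite // ltnW.
Qed.

(** The vector field \sum_n q_n d/dV_n. A coefficient of f involves finitely
    many variables, so that the sum is finite in each degree. *)
Definition vfield (q : nat -> P) f : E :=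
  Fps (fun a => \sum_(n \in [set: nat]%classic) q n * dE n f a).

Lemma vfieldE q f a N : (forall n, (N <= n)%N -> dE n f a = 0) ->
  vfield q f a = \sum_(n < N) q n * dE n f a.
Proof. by move=> f0; apply: fsumT_ord => n Nn; rewrite f0 ?mulr0. Qed.

Section VField.
Variable q : nat -> P.

Lemma vfieldD f g : vfield q (f + g) = vfield q f + vfield q g.
Proof.
apply: fpsP => a; have [N fN] := dE_eventually0 f a; have [M gM] := dE_eventually0 g a.
have fK n : (maxn N M <= n)%N -> dE n f a = 0 by rewrite geq_max => /andP[? _]; apply: fN.
have gK n : (maxn N M <= n)%N -> dE n g a = 0 by rewrite geq_max => /andP[_ ?]; apply: gM.
have fgK n : (maxn N M <= n)%N -> dE n (f + g) a = 0.
  by move=> Kn; rewrite dED fps_addE (fK n Kn) (gK n Kn) addr0.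
rewrite fps_addE (vfieldE q fK) (vfieldE q gK) (vfieldE q fgK) -big_split /=.
by apply: eq_bigr => n _; rewrite dED fps_addE mulrDr.
Qed.

Lemma vfieldM f g : vfield q (f * g) = vfield q f * g + f * vfield q g.
Proof.
apply: fpsP => a; have [N fN] := dE_eventually0 f a; have [M gM] := dE_eventually0 g a.
have fK n i : (maxn N M <= n)%N -> (i <= a)%N -> dE n f i = 0.
  by rewrite geq_max => /andP[? _]; apply: fN.
have gK n i : (maxn N M <= n)%N -> (i <= a)%N -> dE n g i = 0.
  by rewrite geq_max => /andP[_ ?]; apply: gM.
have fgK n : (maxn N M <= n)%N -> dE n (f * g) a = 0.
  move=> Kn; rewrite dEM fps_addE !fps_mulE !big1 ?addr0 // => i _.
    by rewrite gK ?mulr0 ?leq_subr.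
  by rewrite fK ?mul0r ?leq_ord.
have EF i (le_ia : (i <= a)%N) := vfieldE q (fun n Kn => fK n i Kn le_ia).
have EG i (le_ia : (i <= a)%N) := vfieldE q (fun n Kn => gK n i Kn le_ia).
rewrite fps_addE !fps_mulE (vfieldE _ fgK); move: (vfield q f) (vfield q g) EF EG => F G EF EG.
rewrite (eq_bigr (fun n : 'I__ => \sum_(i < a.+1) (q n * dE n f i * g (a - i)%N
     + f i * (q n * dE n g (a - i)%N)))) => [|n _]; last first.
  rewrite dEM fps_addE !fps_mulE -big_split big_distrr /=.
  by apply: eq_bigr => i _; rewrite mulrDr; congr (_ + _); [apply: mulrA | apply: mulrCA].
rewrite exchange_big -big_split /=; apply: eq_bigr => i _.
rewrite EF ?leq_ord // EG ?leq_subr //.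
by rewrite big_distrl big_distrr -big_split.
Qed.

Lemma vfieldC (c : rat) : vfield q (fpsC c%:A) = 0.
Proof.
by apply: fpsP => a; rewrite (vfieldE q (N := 0)) ?big_ord0 // => n _; rewrite dEC.
Qed.

Lemma vfield_evar m : vfield q (evar m) = fpsC (q m).
Proof.
apply: fpsP => a; rewrite (vfieldE q (N := m.+1)) => [|n mn]; last first.
  by rewrite dE_evar gtn_eqF.
rewrite big_ord_recr /= big1 => [|n _]; last by rewrite dE_evar ltn_eqF ?mulr0.
by rewrite add0r dE_evar eqxx fps_1E; case: a => [|a] /=; rewrite ?mulr1 ?mulr0.
Qed.

End VField.

(** * The evolution of V_0 *)

(** The total derivative V_n |-> V_(n+1). *)
Definition Dop := vfield (fun n => pvar n.+1).

Definition pAhat (n : nat) : P :=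
  pvar n.+2 + \sum_(k < n.+1) (pvar (n - k).+1 * pvar k.+1) *+ 'C(n, k).

(** The evolutionary vector field of dV/dt = V_2 + V_1^2: by the Leibniz rule,
    [pAhat n] is the n-th total derivative of V_2 + V_1^2. *)
Definition Aop := vfield pAhat.

(** The defining expressions of the two operators, over P. *)
Definition dtilde_over (f : E) : E :=
  evar 1 * dE 0 f + lsum [set l | (1 <= l)%N]%classic (fun l => evar l.+1 * dE l f).

Definition Ahat_over (f : E) : E :=
  lsum [set m | (1 <= m)%N]%classic (fun m =>
    evar m *
    (lsum [set: nat]%classic (fun k => (evar k.+1 * dE (m + k - 1) f) *+ 'C(m + k - 1, k))
     + if m is m'.+2 then dE m' f else 0)).

Lemma dtilde_vfield f : dtilde_over f = Dop f.
Proof.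
apply: fpsP => a; have [N fN] := dE_eventually0 f a.
rewrite (vfieldE _ (N := N.+1)) => [|n Nn]; last by rewrite fN // ltnW.
rewrite big_ord_recl fps_addE fpsC_mulE; congr (_ + _).
rewrite [LHS](fsum_ord (P := leq 1) (N := N.+1)) => [|l _ Nl]; last first.
  by rewrite fpsC_mulE fN ?mulr0 // ltnW.
rewrite big_mkcond big_ord_recl [LHS]add0r.
by apply: eq_bigr => l _; apply: fpsC_mulE.
Qed.

(** The terms with m + k - 1 = n or m - 2 = n are those that contribute to the
    coefficient of d/dV_n. *)
Lemma Ahat_vfield f : Ahat_over f = Aop f.
Proof.
apply: fpsP => a; have [N fN] := dE_eventually0 f a.
have fN0 n : (N <= n)%N -> dE n f a = 0 by move=> Nn; apply: fN.
rewrite (vfieldE _ fN0).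
have innerE m : (lsum [set: nat]%classic
      (fun k => (evar k.+1 * dE (m.+1 + k - 1) f) *+ 'C(m.+1 + k - 1, k))) a =
    \sum_(k < N) (pvar k.+1 * dE (m + k) f a) *+ 'C(m + k, k).
  rewrite [LHS](fsumT_ord (N := N)) => [|k Nk].
    by apply: eq_bigr => k _; rewrite addSn subn1 fps_mulrnE fpsC_mulE.
  by rewrite addSn subn1 fps_mulrnE fpsC_mulE fN0 ?mulr0 ?mul0rn // (leq_trans Nk) ?leq_addl.
rewrite [LHS](fsum_ord (P := leq 1) (N := N.+2)) => [|[//|[//|m]] _]; last first.
  rewrite !ltnS => Nm; rewrite fpsC_mulE fps_addE innerE [X in _ + X](fN0 _ Nm) addr0 big1 ?mulr0 // => k _.
  by rewrite fN0 ?mulr0 ?mul0rn // (leq_trans Nm) // addSn leqW ?leq_addr.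
rewrite big_mkcond big_ord_recl [LHS]add0r.
rewrite (eq_bigr (fun m : 'I_N.+1 => \sum_(k < N)
   (pvar m.+1 * pvar k.+1 * dE (m + k) f a) *+ 'C(m + k, k)
   + pvar m.+1 * (if m : nat is m'.+1 then dE m' f a else 0))) => [|m _]; last first.
  rewrite fpsC_mulE fps_addE innerE mulrDr big_distrr; congr (_ + _ * _).
    by apply: eq_bigr => k _; rewrite /= mulrnAr mulrA.
  by case: (nat_of_ord m).
rewrite big_split /= (sum_antidiag
   (T := fun m k => (pvar m.+1 * pvar k.+1 * dE (m + k) f a) *+ 'C(m + k, k))) //; last first.
  by move=> m k /fN0 ->; rewrite mulr0 mul0rn.
rewrite big_ord_recl /= mulr0 add0r -big_split; apply: eq_bigr => n _ /=.
rewrite /pAhat mulrDl addrC; congr (_ + _); rewrite big_distrl.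
by apply: eq_bigr => k _; rewrite subnK ?leq_ord //= mulrnAl.
Qed.

Let DD : forall f g, Dop (f + g) = Dop f + Dop g := vfieldD _.
Let DM : forall f g, Dop (f * g) = Dop f * g + f * Dop g := vfieldM _.
Let AD : forall f g, Aop (f + g) = Aop f + Aop g := vfieldD _.
Let AM : forall f g, Aop (f * g) = Aop f * g + f * Aop g := vfieldM _.

Lemma Dop_evar m : Dop (evar m) = evar m.+1.
Proof. exact: vfield_evar. Qed.

Lemma iter_Dop_evar n m : iter n Dop (evar m) = evar (n + m).
Proof. by elim: n => //= n ->; rewrite Dop_evar. Qed.

Lemma Aop_evar m : Aop (evar m) = iter m Dop (evar 2 + evar 1 * evar 1).
Proof.
rewrite /Aop vfield_evar (iter_derD DD) (iter_derM DD DM) iter_Dop_evar addn2 raddfD raddf_sum.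
congr (_ + _); apply: eq_bigr => k _.
by rewrite !iter_Dop_evar !addn1 raddfMn; congr (_ *+ _); apply: rmorphM.
Qed.

(** The polynomial expressions in the variables. Identities between derivations
    are checked on the variables and propagate to these elements, and all
    iterates of the two operators on V_0 are of this form. *)
Inductive epoly : E -> Prop :=
| epoly_var m : epoly (evar m)
| epoly_add f g : epoly f -> epoly g -> epoly (f + g)
| epoly_mul f g : epoly f -> epoly g -> epoly (f * g).

Lemma epoly_Dop f : epoly f -> epoly (Dop f).
Proof.
elim=> [m|g h _ IHg _ IHh|g h pg IHg ph IHh].
- by rewrite Dop_evar; apply: epoly_var.
- by rewrite DD; apply: epoly_add.
by rewrite DM; apply: epoly_add; apply: epoly_mul.
Qed.

Lemma epoly_Aop f : epoly f -> epoly (Aop f).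
Proof.
elim=> [m|g h _ IHg _ IHh|g h pg IHg ph IHh].
- rewrite Aop_evar; elim: m => [|m IHm]; last exact: epoly_Dop.
  by apply: epoly_add; [|apply: epoly_mul]; apply: epoly_var.
- by rewrite AD; apply: epoly_add.
by rewrite AM; apply: epoly_add; apply: epoly_mul.
Qed.

(** The commutator of two derivations is a derivation, and this one vanishes on
    the variables: A V_(m+1) = D^(m+1) (V_2 + V_1^2) = D A V_m. *)
Lemma Aop_DopC f : epoly f -> Aop (Dop f) = Dop (Aop f).
Proof.
elim=> [m|g h _ IHg _ IHh|g h _ IHg _ IHh].
- by rewrite Dop_evar !Aop_evar.
- by rewrite DD !AD DD IHg IHh.
rewrite DM AD !AM !DD !DM IHg IHh.
by rewrite [in RHS]addrACA [X in _ + X]addrC -!addrA; congr (_ + _); rewrite !addrA; congr (_ + _); rewrite addrC.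
Qed.

Lemma iter_Aop_DopC k f : epoly f -> iter k Aop (Dop f) = Dop (iter k Aop f).
Proof.
move=> pf; elim: k => //= k ->; apply: Aop_DopC.
by elim: k => //= k; apply: epoly_Aop.
Qed.

Definition escale (c : rat) f : E := Fps (fun a => c *: f a).

Lemma escaleE c f : escale c f = fpsC c%:A * f.
Proof. by apply: fpsP => a; rewrite fpsC_mulE -scalerAl mul1r. Qed.

Lemma vfield_scale q c f : vfield q (escale c f) = escale c (vfield q f).
Proof. by rewrite !escaleE vfieldM vfieldC mul0r add0r. Qed.

Definition exp_half_over (D : E -> E) (f : E) : fps E :=
  Fps (fun k => escale (2 ^ k * k`!)%:R^-1 (iter k D f)).

(** The series e^(t A / 2) V_0 in t. *)
Definition Wser := exp_half_over Aop (evar 0).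

(** The coefficient of t^k in D^2 u + (D u)^2. *)
Definition pde_rhs (u : nat -> E) (k : nat) : E :=
  Dop (Dop (u k)) + \sum_(i < k.+1) Dop (u i) * Dop (u (k - i)%N).

Definition econst (c : rat) : E := fpsC c%:A.

Lemma econst1 : econst 1 = 1.
Proof. by rewrite /econst scale1r rmorph1. Qed.

Lemma econstM c d : econst (c * d) = econst c * econst d.
Proof. by rewrite /econst -rmorphM -scalerAl mul1r scalerA. Qed.

Lemma econst_mulE c f a : (econst c * f) a = c *: f a.
Proof. by rewrite -escaleE. Qed.

Lemma econst_nat n : econst n%:R = n%:R.
Proof. by rewrite /econst scaler_nat rmorph_nat. Qed.

Lemma mulrn_econst f n : f *+ n = econst n%:R * f.
Proof. by rewrite econst_nat mulr_natl. Qed.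

Lemma vfield_econst q c f : vfield q (econst c * f) = econst c * vfield q f.
Proof. by rewrite -!escaleE vfield_scale. Qed.

Lemma Dop_econst c f : Dop (econst c * f) = econst c * Dop f.
Proof. exact: vfield_econst. Qed.

Lemma Dop_iter_Aop k m : Dop (iter k Aop (evar m)) = iter k Aop (evar m.+1).
Proof. by rewrite -iter_Aop_DopC ?Dop_evar //; apply: epoly_var. Qed.

Definition half_fact (k : nat) : rat := (2 ^ k * k`!)%:R^-1.

Lemma half_factS k : half_fact k.+1 * (2 * k.+1)%:R = half_fact k.
Proof.
rewrite /half_fact expnS factS !natrM.
have h1 : (2 ^ k)%:R != 0 :> rat by rewrite pnatr_eq0 -lt0n expn_gt0.
have h2 : k`!%:R != 0 :> rat by rewrite pnatr_eq0 -lt0n fact_gt0.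
have h3 : k.+1%:R != 0 :> rat by rewrite pnatr_eq0.
by field; rewrite h1 h2 nat1r h3.
Qed.

Lemma half_fact_bin k i : (i <= k)%N ->
  half_fact k * 'C(k, i)%:R = half_fact i * half_fact (k - i).
Proof.
move=> le_ik; rewrite /half_fact -(bin_fact le_ik) -{1}(subnKC le_ik) expnD !natrM.
have h1 n : (2 ^ n)%:R != 0 :> rat by rewrite pnatr_eq0 -lt0n expn_gt0.
have h2 n : n`!%:R != 0 :> rat by rewrite pnatr_eq0 -lt0n fact_gt0.
have h3 : 'C(k, i)%:R != 0 :> rat by rewrite pnatr_eq0 -lt0n bin_gt0.
by field; rewrite !h1 !h2 h3.
Qed.

(** One factor A of A^(k+1) V_0 is applied first and gives V_2 + V_1^2; the
    others are distributed over the product V_1 V_1 and commute with D. *)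
Lemma Wser_pde k : Wser k.+1 *+ (2 * k.+1) = pde_rhs Wser k.
Proof.
have WE n : Wser n = econst (half_fact n) * iter n Aop (evar 0).
  by rewrite -escaleE.
have DWE n : Dop (Wser n) = econst (half_fact n) * iter n Aop (evar 1).
  by rewrite WE Dop_econst Dop_iter_Aop.
rewrite /pde_rhs DWE Dop_econst Dop_iter_Aop.
rewrite WE iterSr Aop_evar (iter_derD AD) (iter_derM AD AM) mulrn_econst mulrA -econstM.
rewrite mulrC [_%:R * _]mulrC half_factS mulrC mulrDr; congr (_ + _).
rewrite mulr_sumr; apply: eq_bigr => i _.
rewrite mulrn_econst mulrA -econstM half_fact_bin ?leq_ord // !DWE econstM.
rewrite [iter (k - i) _ _ * _]mulrC; exact: mulrACA.
Qed.

(** * Logarithms of power series *)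

Implicit Types (F G : fps E).

Lemma fpsP2 F G : (forall k a, F k a = G k a) -> F = G.
Proof. by move=> eqFG; apply: fpsP => k; apply: fpsP => a. Qed.

(** The order of a power series in t and V_0, for the total degree. *)
Definition tord n F := forall k a, (k + a < n)%N -> F k a = 0.

Lemma fps2_mulE F G k a : (F * G) k a =
  \sum_(i < k.+1) \sum_(b < a.+1) F i b * G (k - i)%N (a - b)%N.
Proof. by rewrite fps_mulE fps_sumE. Qed.

Lemma tordM n m F G : tord n F -> tord m G -> tord (n + m) (F * G).
Proof.
move=> nF mG k a lt; rewrite fps2_mulE big1 // => i _; rewrite big1 // => b _.
have [lt_n|le_n] := ltnP (i + b) n; first by rewrite nF // mul0r.
rewrite mG ?mulr0 //; have := leq_ord i; have := leq_ord b; lia.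
Qed.

Lemma tord0 F : tord 0 F. Proof. by []. Qed.

Lemma tordX n G : tord 1 G -> tord n (G ^+ n).
Proof.
by move=> oG; elim: n => [|n IHn] //; rewrite exprS -add1n; apply: tordM.
Qed.

Lemma tordB n F G : tord n F -> tord n G -> tord n (F - G).
Proof. by move=> nF nG k a lt; rewrite !fps_subE nF // nG // subrr. Qed.

Definition log_over F : fps E := Fps (fun k => Fps (fun a =>
  \sum_(j \in [set j | (1 <= j)%N]%classic) ((-1) ^+ j.+1 / j%:R) *: ((F - 1) ^+ j) k a)).

Definition tconst (c : rat) : fps E := fpsC (econst c).

Lemma tconstE c F k a : (tconst c * F) k a = c *: F k a.
Proof. by rewrite fpsC_mulE /econst fpsC_mulE -scalerAl mul1r. Qed.

Lemma tconst1 : tconst 1 = 1.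
Proof. by rewrite /tconst econst1 rmorph1. Qed.

Lemma tconstM c d : tconst (c * d) = tconst c * tconst d.
Proof. by rewrite /tconst econstM rmorphM. Qed.

Lemma tconst_nat n : tconst n%:R = n%:R.
Proof. by rewrite /tconst econst_nat rmorph_nat. Qed.

Lemma mulrn_tconst F n : F *+ n = tconst n%:R * F.
Proof. by rewrite tconst_nat mulr_natl. Qed.

Lemma tconst_sign n : tconst ((-1) ^+ n) = (-1) ^+ n.
Proof.
elim: n => [|n IHn]; first by rewrite tconst1.
by rewrite !exprS tconstM IHn /tconst /econst scaleN1r !rmorphN1.
Qed.

Definition log_trunc J G : fps E :=
  \sum_(j < J) tconst ((-1) ^+ j.+2 / j.+1%:R) * G ^+ j.+1.

Lemma log_truncE J F : F 0 0 = 1 -> tord J.+1 (log_over F - log_trunc J (F - 1)).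
Proof.
move=> F00 k a lt; have oG : tord 1 (F - 1).
  by move=> [|//] [|//] _; rewrite !fps_subE F00 subrr.
rewrite !fps_subE; apply/eqP; rewrite subr_eq0; apply/eqP.
rewrite [LHS](fsum_ord (P := leq 1) (N := J.+1)) => [|j _ lt_j]; last first.
  by rewrite (tordX oG) ?scaler0 // (leq_trans lt).
rewrite big_mkcond big_ord_recl [LHS]add0r /log_trunc !fps_sumE.
by apply: eq_bigr => j _; rewrite tconstE.
Qed.

(** With G = F - 1, the partial sums of the Mercator series have the derivative
    (\sum_(j < J) (-G)^j) dG, and multiplying by F = 1 - (-G) leaves
    dG - (-G)^J dG. As d lowers the order by at most one, letting J grow gives
    the identity in each degree. *)
Lemma log_deriv (d : fps E -> fps E) F : F 0 0 = 1 ->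
  (forall G H, d (G + H) = d G + d H) ->
  (forall G H, d (G * H) = d G * H + G * d H) ->
  (forall c, d (tconst c) = 0) ->
  (forall n G, tord n.+1 G -> tord n (d G)) ->
  d (log_over F) * F = d F.
Proof.
move=> F00 dD dM dC dO; set G := F - 1.
have oG : tord 1 G by move=> [|//] [|//] _; rewrite !fps_subE F00 subrr.
have d1 : d 1 = 0 by rewrite -tconst1 dC.
have dF : d F = d G by rewrite /G (derB dD) d1 subr0.
(* The geometric series. *)
have geo J : (\sum_(j < J) (- G) ^+ j) * F = 1 - (- G) ^+ J.
  have FE : F = - (- G - 1) by rewrite opprB opprK addrC subrK.
  by rewrite FE mulrN mulrC -subrX1 opprB.
have dT J : d (log_trunc J G) * F = d G - (- G) ^+ J * d G.
  have -> : d (log_trunc J G) = (\sum_(j < J) (- G) ^+ j) * d G.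
    rewrite (der_sum dD) mulr_suml; apply: eq_bigr => j _.
    rewrite dM dC mul0r add0r (derX dM) mulrn_tconst mulrA -tconstM.
    have sgE : (-1) ^+ j.+2 = (-1) ^+ j :> rat by rewrite -addn2 exprD sqrrN expr1n mulr1.
    by rewrite divfK ?pnatr_eq0 // sgE tconst_sign mulrA -exprNn.
  by rewrite mulrAC geo mulrBl mul1r.
apply: fpsP2 => k a; apply/eqP; rewrite -subr_eq0 -!fps_subE; apply/eqP.
(* Both sides agree in degree k + a as soon as J exceeds it. *)
pose J := (k + a).+1.
have -> : d (log_over F) * F - d F =
    d (log_over F - log_trunc J G) * F - (- G) ^+ J * d G.
  rewrite (derB dD) mulrBl dT dF -addrA opprB; congr (_ + _).
  by rewrite addrAC subrr add0r.
suff : tord J (d (log_over F - log_trunc J G) * F - (- G) ^+ J * d G) by apply.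
apply: tordB.
  by have := tordM (dO _ _ (@log_truncE J F F00)) (@tord0 F); rewrite addn0.
have oNG : tord 1 (- G) by move=> i b lt; rewrite !fps_oppE oG ?oppr0.
by have := tordM (@tordX J (- G) oNG) (@tord0 (d G)); rewrite addn0.
Qed.

(** * The logarithm solves the same evolution equation *)

Lemma dE_coef0 n f a : f a = 0 -> f a.+1 = 0 -> dE n f a = 0.
Proof. by case: n => [|n] /= f0 f1; rewrite ?f0 ?f1 ?mul0rn ?dP0. Qed.

Lemma Dop_coef0 f a : f a = 0 -> f a.+1 = 0 -> Dop f a = 0.
Proof.
move=> f0 f1; rewrite (vfieldE _ (N := 0)) ?big_ord0 // => n _.
exact: dE_coef0.
Qed.

Definition G0exp : E := Fps (fun a => a`!%:R^-1%:A).

Lemma dE0_G0exp : dE 0 G0exp = G0exp.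
Proof.
apply: fpsP => a /=; rewrite -scaler_nat scalerA; congr (_ *: _).
have h1 : a`!%:R != 0 :> rat by rewrite pnatr_eq0 -lt0n fact_gt0.
have h2 : a.+1%:R != 0 :> rat by rewrite pnatr_eq0.
by rewrite factS natrM invfM mulrA divff // mul1r.
Qed.

(** The series e^(t D^2 / 2) e^(V_0) in t, and its logarithm. *)
Definition Fser := exp_half_over (fun f => Dop (Dop f)) G0exp.
Definition Lser := log_over Fser.

Lemma FserE k : Fser k = econst (half_fact k) * iter k (fun f => Dop (Dop f)) G0exp.
Proof. by rewrite -escaleE. Qed.

Lemma Fser0 : Fser 0 = G0exp.
Proof. by rewrite FserE /half_fact invr1 econst1 mul1r. Qed.

Lemma Fser00 : Fser 0 0 = 1.
Proof. by rewrite Fser0 /= invr1 scale1r. Qed.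

(** The constant coefficient of F is 1, so F can be cancelled. *)
Lemma Fser_lreg : GRing.lreg Fser.
Proof. by apply: fps_lreg; apply: fps_lreg; rewrite Fser00; apply: lreg1. Qed.

Lemma G0exp_lreg : GRing.lreg G0exp.
Proof. by apply: fps_lreg; rewrite -Fser0 Fser00; apply: lreg1. Qed.

Lemma Fser_heat k : Fser k.+1 *+ (2 * k.+1) = Dop (Dop (Fser k)).
Proof.
by rewrite !FserE !Dop_econst mulrn_econst mulrA -econstM [X in econst X]mulrC half_factS.
Qed.

Lemma Lser_dt : fps_deriv Lser * Fser = fps_deriv Fser.
Proof.
apply: log_deriv => [|G H|G H|c|n G oG k a lt]; first exact: Fser00.
- by apply: fpsP => k; apply: mulrnDl.
- exact: fps_derivM.
- by apply: fpsP => k; apply: mul0rn.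
- by rewrite /= fps_mulrnE oG ?mul0rn // addSn.
Qed.

(** The logarithmic derivative, for a derivation acting on the coefficients of
    the powers of t. *)
Lemma Lser_map (D : E -> E) : (forall f g, D (f + g) = D f + D g) ->
  (forall f g, D (f * g) = D f * g + f * D g) -> (forall c, D (econst c) = 0) ->
  (forall f a, f a = 0 -> f a.+1 = 0 -> D f a = 0) ->
  fps_map D Lser * Fser = fps_map D Fser.
Proof.
move=> dD dM dC d0; apply: log_deriv => [|G H|G H|c|n G oG k a lt]; first exact: Fser00.
- by apply: fpsP => k; apply: dD.
- exact: fps_map_deriv.
- by apply: fpsP => -[|k]; [apply: dC | apply: (der0 dD)].
- by apply: d0; apply: oG; rewrite ?addnS // ltnW.
Qed.

Lemma Lser_Dop : fps_map Dop Lser * Fser = fps_map Dop Fser.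
Proof.
by apply: Lser_map; [apply: DD | apply: DM | move=> c; apply: vfieldC | apply: Dop_coef0].
Qed.

Lemma natmulI n : injective (fun x : P => x *+ n.+1).
Proof. by move=> x y /=; rewrite -!scaler_nat; apply: scalerI; rewrite pnatr_eq0. Qed.

Lemma natmulEI n : injective (fun f : E => f *+ n.+1).
Proof.
move=> f g eqfg; apply: fpsP => a; apply: (@natmulI n) => /=.
by rewrite -!fps_mulrnE [f *+ n.+1]eqfg.
Qed.

(** This is log e^(V_0) = V_0: the derivative of the left-hand side with respect
    to V_0 is 1, and its constant coefficient vanishes. *)
Lemma Lser0 : Lser 0 = evar 0.
Proof.
have dV0 : fps_map (dE 0) Lser * Fser = fps_map (dE 0) Fser.
  apply: Lser_map; [exact: dED | exact: dEM | by move=> c; apply: dEC | exact: dE_coef0].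
have {dV0} dL : dE 0 (Lser 0) * Fser 0 = dE 0 (Fser 0).
  by have := congr1 (fun G : fps E => G 0%N) dV0; rewrite fps_mul0E.
rewrite Fser0 dE0_G0exp in dL.
have {dL} dL : dE 0 (Lser 0) = 1.
  by apply: G0exp_lreg; rewrite mulr1 mulrC; exact: dL.
apply: fpsP => -[|a].
  rewrite /Lser /log_over /= fsbig1 // => j j1.
  have oG : tord 1 (Fser - 1).
    by move=> [|//] [|//] _; rewrite !fps_subE Fser00 subrr.
  by rewrite (@tordX j _ oG) ?scaler0.
apply: (@natmulI a); have := congr1 (fun f : E => f a) dL.
rewrite fps_1E /= => ->; case: a => [|a] //=; by rewrite mul0rn.
Qed.

(** From D L F = D F follows D^2 F = (D^2 L + (D L)^2) F, while the heat equation
    says D^2 F = 2 dF/dt = 2 dL/dt F. *)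
Lemma Lser_pde k : Lser k.+1 *+ (2 * k.+1) = pde_rhs Lser k.
Proof.
have eqD : fps_map Dop (fps_map Dop Lser) + fps_map Dop Lser * fps_map Dop Lser
    = fps_deriv Lser *+ 2.
  apply: Fser_lreg; rewrite mulrDr mulrnAr [Fser * fps_deriv _]mulrC Lser_dt.
  rewrite [X in _ + X]mulrA [Fser * fps_map Dop Lser]mulrC Lser_Dop.
  have := fps_map_deriv DD DM (fps_map Dop Lser) Fser.
  rewrite Lser_Dop [X in _ = X + _]mulrC [X in _ = _ + X]mulrC => <-.
  apply: fpsP => j; rewrite fps_mulrnE; apply: etrans (esym (Fser_heat j)) _.
  by rewrite mulnC mulrnA.
have := congr1 (fun G : fps E => G k) eqD.
by rewrite fps_mulrnE fps_addE fps_mulE mulnC mulrnA => <-.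
Qed.

Lemma Lser_Wser : Lser = Wser.
Proof.
apply: fpsP => k; elim/ltn_ind: k => -[_|k IHk].
  by rewrite Lser0 -[RHS]/(escale _ _) escaleE -[fpsC _]/(econst (half_fact 0)) /half_fact invr1 econst1 mul1r.
apply: (@natmulEI (2 * k.+1).-1); rewrite prednK // Lser_pde Wser_pde /pde_rhs.
congr (Dop (Dop _) + _); first exact: IHk.
by apply: eq_bigr => i _; rewrite !IHk // ltnS ?leq_subr // leq_ord.
Qed.

(** * The logarithm counts connected graphs *)

Lemma Dop_fpsC p : exists q, Dop (fpsC p) = fpsC q.
Proof.
exists (Dop (fpsC p) 0%N); apply: fpsP => -[|a] //.
exact: Dop_coef0.
Qed.

Lemma Dop_G0exp : Dop G0exp = G0exp * fpsC (pvar 1).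
Proof.
rewrite mulrC; apply: fpsP => a; rewrite fpsC_mulE -{2}dE0_G0exp.
rewrite (vfieldE _ (N := 1)) ?big_ord1 // => -[//|n] _.
exact: dP1.
Qed.

(** Every total derivative of e^(V_0) is e^(V_0) times a polynomial in V_1, V_2,
    ...; its constant coefficient in V_0 therefore determines it. *)
Lemma iter_Dop_G0exp m : iter m Dop G0exp = G0exp * fpsC (iter m Dop G0exp 0%N).
Proof.
have [p ->] : exists p, iter m Dop G0exp = G0exp * fpsC p.
  elim: m => [|m [p /= ->]]; first by exists 1; rewrite rmorph1 mulr1.
  have [q qE] := Dop_fpsC p; exists (pvar 1 * p + q).
  by rewrite DM Dop_G0exp qE rmorphD rmorphM mulrDr mulrA.
by rewrite fps_mul0E -[G0exp 0%N]/(_%:A) invr1 scale1r mul1r.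
Qed.

(** A total derivative lowers the order in V_0 by at most one. *)
Lemma iter_Dop_coef0 n m f : (forall a, (a <= n + m)%N -> f a = 0) ->
  forall a, (a <= n)%N -> iter m Dop f a = 0.
Proof.
elim: m n => [|m IHm] n f0 a le_an; first by rewrite f0 ?addn0.
have f1 : forall b, (b <= n.+1)%N -> iter m Dop f b = 0.
  by apply: IHm => b; rewrite addSnnS; apply: f0.
by apply: Dop_coef0; apply: f1; rewrite // leqW.
Qed.

Lemma evar0X k a : (evar 0 ^+ k) a = (a == k)%:R.
Proof.
elim: k a => [|k IHk] a; first exact: fps_1E.
rewrite exprS fps_mulE; case: a => [|a].
  by rewrite big_ord1 mul0r.
rewrite 2!big_ord_recl mul0r add0r mul1r subSS subn0 IHk eqSS big1 ?addr0 //.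
by move=> i _; rewrite mul0r.
Qed.

Lemma card_fiber_ext k m (a : {ffun 'I_m.+1 -> 'I_k}) v :
  #|[set h | a h == v]| =
  ((a ord0 == v) + #|[set h : 'I_m | a (lift ord0 h) == v]|)%N.
Proof.
by rewrite -!sum1dep_card big_mkcond big_ord_recl [in RHS]big_mkcond; case: (_ == v).
Qed.

(** The m derivations are distributed over the k factors V_0: the map a records
    which factor each of them hits. *)
Lemma iter_Dop_evar0X k m :
  iter m Dop (evar 0 ^+ k) = \sum_(a : {ffun 'I_m -> 'I_k}) val_weight evar a.
Proof.
elim: m => [|m IHm].
  have f0E (a b : {ffun 'I_0 -> 'I_k}) : a = b by apply/ffunP; case.
  pose f0 : {ffun 'I_0 -> 'I_k} := ffun0 (card_ord 0).
  rewrite (big_pred1 f0) => [|a]; last by apply/esym/eqP/f0E.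
  rewrite /val_weight (eq_bigr (fun=> evar 0)) => [|v _].
    by rewrite prodr_const card_ord.
  by rewrite (_ : #|_| = 0%N) //; apply: eq_card0 => -[].
rewrite iterS IHm (der_sum DD).
(* A map on m + 1 points is its value u at the first point and its restriction
   a to the others. *)
pose ext (p : 'I_k * {ffun 'I_m -> 'I_k}) : {ffun 'I_m.+1 -> 'I_k} :=
  [ffun h => oapp p.2 p.1 (unlift ord0 h)].
pose tl (a : {ffun 'I_m.+1 -> 'I_k}) := (a ord0, [ffun h : 'I_m => a (lift ord0 h)]).
rewrite (reindex ext) /=; last first.
  exists tl => [[u a] _|a _].
    by congr pair; [rewrite ffunE unlift_none | apply/ffunP => h; rewrite !ffunE liftK].
  apply/ffunP => h; rewrite ffunE.
  by case: (unliftP ord0 h) => [j ->|->]; rewrite ?liftK ?unlift_none /= ?ffunE.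
rewrite -(pair_big predT predT (fun u a => val_weight evar (ext (u, a)))) exchange_big /=.
apply: eq_bigr => a _; rewrite (der_prod DM); apply: eq_bigr => u _.
apply: eq_bigr => v _; rewrite Dop_evar card_fiber_ext ffunE unlift_none /= eq_sym.
have -> : #|[set h | ext (u, a) (lift ord0 h) == v]| = #|[set h | a h == v]|.
  by apply: eq_card => h; rewrite !inE ffunE liftK.
by case: eqP.
Qed.

(** Only the terms V_0^k / k! of e^(V_0) with k <= m can reach degree 0 in V_0
    after m derivations. *)
Lemma iter_Dop_G0exp_coef0 m : iter m Dop G0exp 0%N =
  \sum_(k < m.+1) k`!%:R^-1 *: \sum_(a : {ffun 'I_m -> 'I_k}) val_weight pvar a.
Proof.
(* The truncation of e^(V_0) in degree m. *)
pose T := \sum_(k < m.+1) econst k`!%:R^-1 * evar 0 ^+ k.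
rewrite -[G0exp](subrK T) (iter_derD DD) fps_addE (@iter_Dop_coef0 0 m) ?add0r //; last first.
  move=> a; rewrite add0n => le_am; rewrite fps_subE fps_sumE.
  rewrite (bigD1 (inord a)) // [X in _ - (_ + X)]big1 => [|k].
    by rewrite inordK // addr0 econst_mulE evar0X eqxx subrr.
  rewrite -val_eqE => nk; have {nk} ka : (a == k) = false.
    by apply/negbTE; move: nk; rewrite /= inordK // eq_sym.
  by rewrite econst_mulE evar0X ka scaler0.
have iterE (u : nat -> E) : iter m Dop (\sum_(k < m.+1) u k) = \sum_(k < m.+1) iter m Dop (u k).
  apply: (big_morph _ (iter_derD DD m)).
  by elim: (m) => //= n ->; apply: (der0 DD).
have iterC c (f : E) : iter m Dop (econst c * f) = econst c * iter m Dop f.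
  by elim: (m) => //= n ->; rewrite Dop_econst.
rewrite (iterE (fun k => econst k`!%:R^-1 * evar 0 ^+ k)) fps_sumE; apply: eq_bigr => k _.
rewrite iterC iter_Dop_evar0X econst_mulE fps_sumE; congr (_ *: _).
apply: eq_bigr => a _; rewrite /val_weight fps_prod0E; apply: eq_bigr => v _.
by case: #|_|.
Qed.

Lemma Fser_graph_total e : Fser e = G0exp * fpsC (graph_total pvar (2 * e)).
Proof.
have it2 : iter e (fun f => Dop (Dop f)) G0exp = iter (2 * e) Dop G0exp.
  by elim: (e) => // n IHn; rewrite mulnS iterS IHn.
rewrite FserE it2 iter_Dop_G0exp mulrCA -rmorphM; congr (_ * fpsC _).
rewrite -scalerAl mul1r iter_Dop_G0exp_coef0 scaler_sumr.
by apply: eq_bigr => k _; rewrite graph_coef_even.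
Qed.

(** [even_exp_formula] says that the generating function of connected graphs
    has the same logarithmic derivative in t as F, so that the two series have
    the same derivative. *)
Lemma Lser_conn_total e : (0 < e)%N -> Lser e = fpsC (conn_total pvar (2 * e)).
Proof.
pose M : fps E := Fps (fun e => fpsC (conn_total pvar (2 * e))).
suff eqLM : fps_deriv Lser = fps_deriv M.
  case: e => // e _; have := congr1 (fun G : fps E => G e) eqLM.
  exact: natmulEI.
apply: Fser_lreg; rewrite mulrC Lser_dt mulrC; apply: fpsP => n.
transitivity (Fser n.+1 *+ n.+1); first by [].
rewrite Fser_graph_total -mulrnAr -raddfMn -[_ *+ n.+1]mulr_natl even_exp_formula //.
rewrite big_ord_recl mul0r add0r raddf_sum mulr_sumr fps_mulE.
apply: eq_bigr => i _; rewrite Fser_graph_total [nat_of_ord (lift ord0 i)]/= subSS.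
rewrite (_ : fps_deriv M i = fpsC (i.+1%:R * conn_total pvar (2 * i.+1))).
  by rewrite [RHS]mulrCA; congr (_ * _); rewrite mulrA; apply: rmorphM.
by rewrite mulr_natl raddfMn.
Qed.
End DerivV.

(** * Partial derivatives of polynomials *)

Section PolyDeriv.
Implicit Types (p q : polyV) (m n : {cmonom nat}) (a b c : rat).

(** Monomials under a name of their own: the rules below suffice to calculate
    with them, without unfolding the finitely supported functions that represent
    polynomials. *)
Definition mon (c : rat) (m : {cmonom nat}) : polyV := << c *g m >>.

Lemma polyV_ind (P : polyV -> Prop) : P 0 -> (forall p q, P p -> P q -> P (p + q)) ->
  (forall c m, P (mon c m)) -> forall p, P p.
Proof. by move=> P0 PD PU p; rewrite (monalgE p); elim/big_ind: _ => // m _; apply: PU. Qed.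

Lemma monM a b m n : mon a m * mon b n = mon (a * b) (mulcm m n).
Proof. exact: fgmulUU. Qed.

Lemma monD a b m : mon (a + b) m = mon a m + mon b m.
Proof. exact: monalgUD. Qed.

Lemma mon0 m : mon 0 m = 0.
Proof. exact: monalgU0. Qed.

Lemma monC c : c%:MP = mon c (onecm nat). Proof. by []. Qed.
Lemma mon1 : mon 1 (onecm nat) = 1. Proof. by []. Qed.
Lemma mon_ucm i : << ucm i >> = mon 1 (ucm i). Proof. by []. Qed.

Definition monom_deriv (i : nat) m : polyV := mon (m i)%:R (divcm m (ucm i)).

Lemma polyV_derivE i p : polyV_deriv i p = mmap (@malgC {cmonom nat} rat) (monom_deriv i) p.
Proof.
rewrite /polyV_deriv mmapE; apply: eq_bigr => m _.
move: (p@_m : rat) => c; rewrite -mulr_natr.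
by rewrite [RHS]monM [mulcm _ _]mul0cm.
Qed.

Lemma polyV_deriv_mon i c m : polyV_deriv i (mon c m) = mon (c *+ m i) (divcm m (ucm i)).
Proof. by rewrite polyV_derivE mmapU [LHS]monM [mulcm _ _]mul0cm mulr_natr. Qed.

Lemma polyV_deriv_is_zmod_morphism i : zmod_morphism (polyV_deriv i).
Proof. by move=> p q; rewrite !polyV_derivE raddfB. Qed.
HB.instance Definition _ i :=
  GRing.isZmodMorphism.Build polyV polyV (polyV_deriv i) (polyV_deriv_is_zmod_morphism i).

Lemma polyV_deriv0 i : polyV_deriv i 0 = 0. Proof. exact: raddf0. Qed.
Lemma polyV_derivD i p q : polyV_deriv i (p + q) = polyV_deriv i p + polyV_deriv i q.
Proof. exact: raddfD. Qed.

Local Opaque mon polyV_deriv.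

Lemma polyV_derivM i p q :
  polyV_deriv i (p * q) = polyV_deriv i p * q + p * polyV_deriv i q.
Proof.
elim/polyV_ind: p => [|p1 p2 IH1 IH2|a m]; first by rewrite !(mul0r, polyV_deriv0) add0r.
  apply: (@leibnizDl polyV (polyV_deriv i) _ _ _ _ IH1 IH2); apply: polyV_derivD.
elim/polyV_ind: q => [|q1 q2 IH1 IH2|b n]; first by rewrite !(mulr0, polyV_deriv0) addr0.
  apply: (@leibnizDr polyV (polyV_deriv i) _ _ _ _ IH1 IH2); apply: polyV_derivD.
have E0 : polyV_deriv i (mon a m * mon b n) =
    mon ((a * b) *+ m i) (divcm (mulcm m n) (ucm i)) + mon ((a * b) *+ n i) (divcm (mulcm m n) (ucm i)).
  by rewrite monM polyV_deriv_mon mulcmE mulrnDr monD.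
have E1 : polyV_deriv i (mon a m) * mon b n = mon ((a * b) *+ m i) (divcm (mulcm m n) (ucm i)).
  rewrite polyV_deriv_mon; case: (posnP (m i)) => [->|mi]; first by rewrite !mulr0n !mon0 mul0r.
  rewrite monM mulrnAl; congr mon; apply/eqP/cmP => j.
  rewrite divcmE !mulcmE divcmE ucmE; case: eqP => [<-|_]; lia.
have E2 : mon a m * polyV_deriv i (mon b n) = mon ((a * b) *+ n i) (divcm (mulcm m n) (ucm i)).
  rewrite polyV_deriv_mon; case: (posnP (n i)) => [->|mi]; first by rewrite !mulr0n !mon0 mulr0.
  rewrite monM mulrnAr; congr mon; apply/eqP/cmP => j.
  rewrite divcmE !mulcmE divcmE ucmE; case: eqP => [<-|_]; lia.
exact: etrans E0 (esym (congr2 +%R E1 E2)).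
Qed.

Lemma polyV_derivC i c : polyV_deriv i c%:MP = 0.
Proof. by rewrite monC polyV_deriv_mon onecmE mulr0n mon0. Qed.

Lemma polyV_deriv_ucm i j : polyV_deriv i << ucm j >> = (j == i)%:R.
Proof.
rewrite mon_ucm polyV_deriv_mon ucmE; case: eqP => [->|_]; last by rewrite mon0.
by rewrite -[RHS]mon1; congr mon; apply/eqP/cmP => k; rewrite divcmE subnn onecmE.
Qed.

Lemma polyV_deriv_eventually0 p : exists N, forall i, (N <= i)%N -> polyV_deriv i p = 0.
Proof.
elim/polyV_ind: p => [|p q [N pN] [M qM]|c m].
- by exists 0%N => i _; rewrite polyV_deriv0.
- exists (maxn N M) => i; rewrite geq_max => /andP[Ni Mi].
  by rewrite polyV_derivD pN ?qM ?addr0.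
exists (\max_(j <- finsupp (cmonom_val m)) j.+1)%N => i mi.
rewrite polyV_deriv_mon; suff -> : m i = 0%N by rewrite mulr0n mon0.
apply/eqP; rewrite cmE_eq0; apply: contraL mi => mi; rewrite -ltnNge.
exact: (@leq_bigmax_seq nat _ predT (fun j => j.+1) i mi isT).
Qed.

End PolyDeriv.

(** * Substituting the series V_n(z) *)

Definition monom_subst (m : {cmonom nat}) : fps rat :=
  \prod_(i <- finsupp (cmonom_val m)) Vseries i.+1 ^+ m i.

Lemma monom_substEw (d : {fset nat}) m : (finsupp (cmonom_val m) `<=` d)%fset ->
  monom_subst m = \prod_(i <- d) Vseries i.+1 ^+ m i.
Proof.
move=> sub; rewrite /monom_subst (big_fset_incl _ sub) // => i _.
by rewrite -cmE_eq0 => /eqP ->; rewrite expr0.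
Qed.

Lemma monom_subst_mmorphism : mmorphism monom_subst.
Proof.
split=> [m n|]; last by rewrite /monom_subst mdom1 big_seq_fset0.
rewrite [LHS](monom_substEw (fsubset_refl _)) mdomD.
rewrite (monom_substEw (fsubsetUl _ (finsupp (cmonom_val n)))).
rewrite (monom_substEw (fsubsetUr (finsupp (cmonom_val m)) _)) -big_split.
by apply: eq_bigr => i _; rewrite cmM exprD.
Qed.
HB.instance Definition _ := isMultiplicative.Build {cmonom nat} (fps rat) monom_subst
  monom_subst_mmorphism.

(** The substitution is the evaluation morphism of the monoid algebra. *)
Lemma polyV_substE p : polyV_subst p = mmap (@fpsC rat) monom_subst p.
Proof. by []. Qed.

Lemma polyV_subst_is_zmod_morphism : zmod_morphism polyV_subst.
Proof. move=> p q; rewrite !polyV_substE; exact: mmap_is_additive. Qed.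
HB.instance Definition _ :=
  GRing.isZmodMorphism.Build polyV (fps rat) polyV_subst polyV_subst_is_zmod_morphism.

Lemma polyV_subst_is_monoid_morphism : monoid_morphism polyV_subst.
Proof.
by case: (@mmap_is_multiplicative _ _ _ (@fpsC rat) monom_subst) => hM h1; split.
Qed.
HB.instance Definition _ :=
  GRing.isMonoidMorphism.Build polyV (fps rat) polyV_subst polyV_subst_is_monoid_morphism.

Lemma polyV_substZ c p : polyV_subst (c *: p) = fpsC c * polyV_subst p.
Proof. rewrite !polyV_substE; exact: mmapZ. Qed.

Lemma polyV_subst_ucm i : polyV_subst << ucm i >> = Vseries i.+1.
Proof.
rewrite polyV_substE mmapU [LHS]mul1r [LHS]/monom_subst mdomU big_seq_fset1.
by rewrite cmUU expr1.
Qed.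

Definition xV (i : nat) : polyV := << ucm i >>.

Lemma xV_derivP i j : polyV_deriv i (xV j) = (i == j)%:R.
Proof. by rewrite polyV_deriv_ucm eq_sym. Qed.

Lemma malgCE (c : rat) : c%:MP = c%:A :> polyV.
Proof. by rewrite -mul_malgC mulr1. Qed.

Lemma xV_deriv1 i (c : rat) : polyV_deriv i c%:A = 0.
Proof. by rewrite -malgCE polyV_derivC. Qed.

Lemma dtilde_Dop f : dtilde f = Dop polyV_deriv xV f.
Proof.
exact: (dtilde_vfield xV polyV_deriv_eventually0).
Qed.

Lemma Ahat_Aop f : Ahat f = Aop polyV_deriv xV f.
Proof.
exact: (Ahat_vfield xV polyV_deriv_eventually0).
Qed.

Lemma expG0_E : expG0 = G0exp _.
Proof. by apply: fpsP => a; apply: malgCE. Qed.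

Lemma log_exp_half :
  fps_log (exp_half (fun f => dtilde (dtilde f)) expG0) = Lser polyV_deriv xV.
Proof.
rewrite expG0_E (_ : (fun f => _) = (fun f => Dop polyV_deriv xV (Dop polyV_deriv xV f))) //.
by apply/funext => f; rewrite !dtilde_Dop.
Qed.

Lemma Ahat_exp_half : exp_half Ahat (Vvar 0) = Wser polyV_deriv xV.
Proof.
by rewrite (_ : Ahat = Aop polyV_deriv xV) //; apply/funext => f; rewrite Ahat_Aop.
Qed.

Lemma log_terms_Ahat_terms : log_terms = Ahat_terms.
Proof.
apply/funext => k; rewrite /log_terms /Ahat_terms log_exp_half Ahat_exp_half.
by rewrite (Lser_Wser polyV_derivD polyV_derivM xV_deriv1 xV_derivP polyV_deriv_eventually0).
Qed.

Lemma polyV_subst0 : polyV_subst 0 = 0. Proof. exact: raddf0. Qed.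

Lemma substV_const p : substV (fpsC p) = polyV_subst p.
Proof.
apply: fpsP => N; rewrite [LHS](fsumT_ord (N := 1)) => [|[//|a] _].
  by rewrite big_ord1 expr0 mulr1.
by rewrite [fpsC p _]/= polyV_subst0 mul0r.
Qed.

Lemma substV_Vvar0 : substV (Vvar 0) = Vseries 0.
Proof.
apply: fpsP => N; rewrite [LHS](fsumT_ord (N := 2)) => [|[//|[//|a]] _]; last first.
  by rewrite [Vvar 0 _]/= polyV_subst0 mul0r.
rewrite (_ : \sum_(i < 2) _ =
  (polyV_subst 0 * Vseries 0 ^+ 0) N + (polyV_subst 1 * Vseries 0 ^+ 1) N); last first.
  by rewrite big_ord_recl big_ord1.
by rewrite polyV_subst0 mul0r fps_0E add0r rmorph1 mul1r expr1.
Qed.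

Lemma rmorph_conn_sum (R S : comNzRingType) (f : {rmorphism R -> S}) (x : nat -> R)
    (V H : finType) : f (conn_sum x V H) = conn_sum (fun n => f (x n)) V H.
Proof.
rewrite /conn_sum rmorph_sum; apply: eq_bigr => a _; rewrite rmorph_sum.
by apply: eq_bigr => o _; rewrite rmorph_prod.
Qed.

(** The first edge of a path towards the vertex of h is attached to v. *)
Lemma connected_valence_gt0 (V H : finType) (a : {ffun H -> V}) (o : {ffun H -> H}) (h : H) v :
  involutive o -> ncomp (bare a o) == 1%N -> (0 < #|[set h | a h == v]|)%N.
Proof.
move=> oK /(@ncomp1P _ _ (bare a o) v oK) /(_ (a h)) /connectP[[|u p] /= pth hE].
  by apply/card_gt0P; exists h; rewrite inE hE.
case/andP: pth => /existsP[h' /andP[/= ah' _]] _.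
by apply/card_gt0P; exists h'; rewrite inE.
Qed.

(** In a connected graph with a half-edge no vertex has valence 0. *)
Lemma eq_conn_sum (R : comNzRingType) (x y : nat -> R) k m :
  (forall n, x n.+1 = y n.+1) -> (0 < m)%N -> conn_sum x 'I_k 'I_m = conn_sum y 'I_k 'I_m.
Proof.
case: m => // m exy _; apply: eq_bigr => a _; apply: eq_bigr => o /andP[/fpf_invP[_ oK] c1].
apply: eq_bigr => v _.
by have := connected_valence_gt0 ord0 v oK c1; case: #|_|.
Qed.

Lemma conn_sum_small (R : comNzRingType) (x : nat -> R) k m :
  (0 < m < k)%N -> conn_sum x 'I_k 'I_m = 0.
Proof.
move=> /andP[m0 mk]; pose y n := if n is n'.+1 then x n'.+1 else 0.
rewrite (eq_conn_sum (y := y)) // /conn_sum big1 // => a _.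
by apply: big1 => o _; apply: val_weight_small.
Qed.

Lemma conn_sum_edgeless (R : comNzRingType) (x : nat -> R) k :
  conn_sum x 'I_k 'I_0 = if k == 1%N then x 0 else 0.
Proof.
pose a0 : {ffun 'I_0 -> 'I_k} := ffun0 (card_ord 0).
pose o0 : {ffun 'I_0 -> 'I_0} := ffun0 (card_ord 0).
have oK : involutive o0 by case.
have fo0 : fpf_inv o0 by apply/fpf_invP; split; case.
rewrite /conn_sum (big_pred1 a0) => [|a]; last by apply/esym/eqP/ffunP; case.
rewrite big_mkcond (big_pred1 o0) => [|o]; last by apply/esym/eqP/ffunP; case.
rewrite fo0 /=.
have connE u v : connect (adj (bare a0 o0)) u v = (u == v).
  apply/idP/eqP => [/connectP[[|w p] /= pth ->] //|->]; last exact: connect0.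
  by case/andP: pth => /existsP[[]].
have wE : k = 1%N -> val_weight x a0 = x 0.
  move=> k1; rewrite /val_weight (eq_bigr (fun=> x 0)) ?prodr_const ?card_ord ?k1 // => v _.
  by congr x; apply: eq_card0 => -[].
case: k a0 connE wE => [|[|k]] a0 connE wE /=.
- have -> : ncomp (bare a0 o0) = 0%N by apply: eq_card0 => -[].
  by [].
- rewrite (introT (@ncomp1P _ _ (bare a0 o0) ord0 oK)) ?wE // => u.
  by rewrite connE [u]ord1.
case: ifP => // /(@ncomp1P _ _ (bare a0 o0) ord0 oK) /(_ (lift ord0 ord0)).
by rewrite connE.
Qed.

(** For e = 0 the only connected graph is a single vertex, of weight V_0(z). A
    connected graph with 2e > 0 half-edges has at most 2e vertices, whence the
    freedom in the choice of K. *)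
Lemma log_terms_conn_sum e K : (2 * e + 1 < K)%N ->
  log_terms e = \sum_(k < K) fpsC (k`! * (2 * e)`!)%:R^-1 * conn_sum Vseries 'I_k 'I_(2 * e).
Proof.
move=> ltK; rewrite /log_terms log_exp_half; have [->|e0] := posnP e.
  rewrite (Lser0 xV polyV_derivD polyV_derivM xV_deriv1).
  rewrite [LHS]substV_Vvar0 (bigD1 (Ordinal (leq_ltn_trans (leq_addl _ _) ltK))) //=.
  rewrite conn_sum_edgeless big1 => [|k].
    by rewrite addr0 muln0 !fact0 muln1 invr1 [RHS]mul1r.
  by rewrite -val_eqE conn_sum_edgeless /= => /negPf ->; rewrite mulr0.
rewrite (Lser_conn_total polyV_derivD polyV_derivM xV_deriv1 xV_derivP polyV_deriv_eventually0 e0).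
rewrite substV_const /conn_total raddf_sum /=.
rewrite (eq_bigr (fun k : 'I__ => fpsC (k`! * (2 * e)`!)%:R^-1 * conn_sum Vseries 'I_k 'I_(2 * e))).
  rewrite (big_ord_widen_cond K predT (fun k => fpsC (k`! * (2 * e)`!)%:R^-1 * conn_sum Vseries 'I_k 'I_(2 * e))).
    rewrite big_mkcond; apply: eq_bigr => k _; case: ltnP => // lt.
    by rewrite conn_sum_small ?mulr0 // muln_gt0 e0.
  by rewrite ltnW // -addn1.
move=> k _; rewrite /conn_coef polyV_substZ rmorph_conn_sum; congr (_ * _).
by apply: eq_conn_sum => [n|]; rewrite ?muln_gt0 ?e0 //= polyV_subst_ucm.
Qed.

(** * Genus assignments *)

Definition fps_monom (c : rat) (d : nat) : fps rat := Fps (fun N => if N == d then c else 0).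

Lemma fps_monomM c d c' d' : fps_monom c d * fps_monom c' d' = fps_monom (c * c') (d + d').
Proof.
apply: fpsP => N; rewrite fps_mulE /=.
have [ltNd|ledN] := ltnP N d.
  rewrite ifF ?big1 // => [i _|]; last by apply/eqP; lia.
  by rewrite ifF ?mul0r //; apply/eqP; have := leq_ord i; lia.
rewrite (bigD1 (inord d)) //= inordK // eqxx big1 ?addr0 => [|i].
  by rewrite -(eqn_add2l d) subnKC //; case: eqP; rewrite ?mulr0.
by rewrite -val_eqE /= inordK // => /negPf ->; rewrite mul0r.
Qed.

Lemma fps_monom_prod (I : finType) (c : I -> rat) (d : I -> nat) :
  \prod_i fps_monom (c i) (d i) = fps_monom (\prod_i c i) (\sum_i d i).
Proof.
apply: (big_rec3 (fun x y z => x = fps_monom y z)) => [|i x y z _ ->].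
  by apply: fpsP => N; rewrite fps_1E /=; case: eqP.
exact: fps_monomM.
Qed.

Lemma eq_prod_coef (R : comNzRingType) (I : finType) (f g : I -> fps R) N :
  (forall i M, (M <= N)%N -> f i M = g i M) ->
  forall M, (M <= N)%N -> (\prod_i f i) M = (\prod_i g i) M.
Proof.
move=> fg; apply: (big_rec2 (fun x y : fps R => forall M, (M <= N)%N -> x M = y M)) => // i x y _ IH M MN.
rewrite !fps_mulE; apply: eq_bigr => j _.
rewrite fg ?IH //; first exact: leq_trans (leq_subr _ _) MN.
exact: leq_trans (leq_ord j) MN.
Qed.

(** The range of genera in V_n(z) expresses exactly the stability condition
    2g - 2 + n > 0, and a genus above b contributes an exponent above N. *)
Lemma Vseries_trunc b n N : (N < 2 * b)%N ->
  Vseries n N = (\sum_(g < b.+1 | (2 < 2 * g + n)%N) fps_monom (chiM g n) (2 * g + n - 2)) N.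
Proof.
move=> Nb; rewrite fps_sumE [RHS]/=.
transitivity (\sum_(0 <= g < maxn N.+2 b.+1 | (2 < 2 * g + n)%N && (2 * g + n == N + 2)%N)
    chiM g n).
  rewrite /Vseries /= (big_nat_widen _ _ (maxn N.+2 b.+1)) ?leq_maxl //.
  rewrite (big_nat_widenl _ 0) //; apply: eq_bigl => g.
  rewrite /Vgmin; case: n => [|[|[|n]]] /=; apply/idP/idP; lia.
transitivity (\sum_(0 <= g < b.+1 | (2 < 2 * g + n)%N && (2 * g + n == N + 2)%N) chiM g n).
  rewrite [RHS](big_nat_widen _ _ (maxn N.+2 b.+1)) ?leq_maxr //.
  apply: eq_bigl => g; apply/idP/idP; lia.
rewrite big_mkord big_mkcondr; apply: eq_bigr => g lt.
by congr (if _ then _ else _); apply/eqP/eqP; lia.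
Qed.

(** Expanding the product assigns a genus to each vertex; the exponents
    2 g_v + n_v - 2 add up to N. *)
Lemma prod_Vseries_coef b k (n : 'I_k -> nat) N : (N < 2 * b)%N ->
  (\prod_v Vseries (n v)) N =
  \sum_(c : {ffun 'I_k -> 'I_b.+1} | [forall v, 2 < 2 * c v + n v]%N &&
      (\sum_v (2 * c v + n v) == N + 2 * k)%N) \prod_v chiM (c v) (n v).
Proof.
move=> Nb.
rewrite (eq_prod_coef (g := fun v => \sum_(g < b.+1)
    (if (2 < 2 * g + n v)%N then fps_monom (chiM g (n v)) (2 * g + n v - 2) else 0)) (N := N)) //;
  last first.
  by move=> v M MN; rewrite (@Vseries_trunc b) ?(leq_ltn_trans MN) // big_mkcond.
rewrite bigA_distr_bigA fps_sumE [RHS]big_mkcondr [RHS]big_mkcond /=.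
apply: eq_bigr => c _; case: ifP => [/forallP st|/negbT]; last first.
  rewrite negb_forall => /existsP[v /negPf nst].
  by rewrite (_ : \prod_i _ = 0) // (bigD1 v) // nst; apply: mul0r.
rewrite (eq_bigr (fun v => fps_monom (chiM (c v) (n v)) (2 * c v + n v - 2))) => [|v _]; last first.
  by rewrite st.
rewrite fps_monom_prod /=; congr (if _ then _ else _).
have -> : (\sum_v (2 * c v + n v) = \sum_v (2 * c v + n v - 2) + 2 * k)%N.
  have -> : (2 * k = \sum_(v < k) 2)%N by rewrite sum_nat_const card_ord mulnC.
  rewrite -big_split /=; apply: eq_bigr => v _.
  by have := st v; lia.
by rewrite eqn_add2r eq_sym.
Qed.

(** * Isomorphism classes and labelled graphs *)

Section Relabelling.
Variables b k m : nat.
Local Notation code := (gcode b k m).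
Local Notation relabG := ({perm 'I_k} * {perm 'I_m})%type.

Definition relabel (c : code) (st : relabG) : code :=
  ([ffun h => st.1 (c.1.1 (st.2^-1%g h))], [ffun h => st.2 (c.1.2 (st.2^-1%g h))],
   [ffun v => c.2 (st.1^-1%g v)]).

Lemma relabel1 : relabel^~ 1%g =1 id.
Proof.
move=> [[a o] g].
by congr (_, _, _); apply/ffunP => x; rewrite ffunE /= !(invg1, perm1).
Qed.

Lemma relabelM (c : code) : act_morph relabel c.
Proof.
move=> [s t] [s' t']; case: c => [[a o] g].
by congr (_, _, _); apply/ffunP => x; rewrite !ffunE /= !(invMg, permM).
Qed.

Canonical relabel_action := TotalAction relabel1 relabelM.

Lemma is_isoE (c c' : code) s t :
  is_iso (decode c) (decode c') s t = (relabel c (s, t) == c').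
Proof.
apply/and3P/eqP => [[/forallP h1 /forallP h2 /forallP h3]|<-].
  case: c c' h1 h2 h3 => [[a o] g] [[a' o'] g'] /= h1 h2 h3.
  congr (_, _, _); apply/ffunP => x; rewrite ffunE /=.
  - by rewrite -(eqP (h1 _)) permKV.
  - by rewrite -(eqP (h2 _)) permKV.
  by apply: val_inj; rewrite /= -(eqP (h3 _)) permKV.
by split; apply/forallP => x; rewrite /= ffunE /= permK.
Qed.

Lemma isomorphicE (c c' : code) :
  isomorphic (decode c) (decode c') = (c' \in orbit relabel_action [set: relabG] c).
Proof.
apply/existsP/imsetP => [[s /existsP[t]]|[[s t] _ ->]].
  by rewrite is_isoE => /eqP <-; exists (s, t); rewrite ?inE.
by exists s; apply/existsP; exists t; rewrite is_isoE.
Qed.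

(** The automorphism group is the stabiliser for the relabelling action. *)
Lemma card_orbit_Aut (c : code) :
  (#|orbit relabel_action [set: relabG] c| * #|Defs.Aut (decode c)| = k`! * m`!)%N.
Proof.
have -> : Defs.Aut (decode c) = 'C_[set: relabG][c | relabel_action]%g.
  apply/setP => -[s t]; rewrite in_setI in_setT [LHS]inE is_isoE.
  exact/eqP/(@astab1P _ _ relabel_action c (s, t)).
by rewrite card_orbit_stab cardsT card_prod !card_Sn.
Qed.

End Relabelling.

Section IsoInvariance.
Variables (V H : finType) (G G' : wgraph V H) (s : {perm V}) (t : {perm H}).
Hypothesis iso : is_iso G G' s t.

Let attE x : att G' (t x) = s (att G x).
Proof. by case/and3P: iso => /forallP/(_ x)/eqP. Qed.
Let hoppE x : hopp G' (t x) = t (hopp G x).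
Proof. by case/and3P: iso => _ /forallP/(_ x)/eqP. Qed.
Let genE v : gen G' (s v) = gen G v.
Proof. by case/and3P: iso => _ _ /forallP/(_ v)/eqP. Qed.

Lemma iso_valence v : valence G' (s v) = valence G v.
Proof.
rewrite /valence -[RHS](card_imset _ (@perm_inj _ t)); apply: eq_card => x.
rewrite -[x](permKV t) inE attE (inj_eq perm_inj) mem_imset ?inE //.
exact: perm_inj.
Qed.

Lemma iso_weight_prod :
  \prod_v chiM (gen G' v) (valence G' v) = \prod_v chiM (gen G v) (valence G v).
Proof.
by rewrite (reindex_inj (@perm_inj _ s)); apply: eq_bigr => v _; rewrite genE iso_valence.
Qed.

(** Stability being invariant, each isomorphism class of stable graphs is a whole
    orbit of the relabelling action. *)
Lemma iso_stable_graph g n : stable_graph g n G -> stable_graph g n G'.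
Proof.
case/and5P=> /forallP oK c1 gE nE st.
have oK' x : hopp G' (hopp G' x) = x.
  by rewrite -[x](permKV t) !hoppE (eqP (oK _)).
have ext' : #|external G'| = #|external G|.
  rewrite -[RHS](card_imset _ (@perm_inj _ t)); apply: eq_card => x.
  rewrite -[x](permKV t) inE hoppE (inj_eq perm_inj) mem_imset ?inE //.
  exact: perm_inj.
have c1' : ncomp G' == 1%N.
  have /card_gt0P[v _] : (0 < ncomp G)%N by rewrite (eqP c1).
  apply/(@ncomp1P _ _ G' (s v) oK') => u; rewrite -[u](permKV s).
  have /(@ncomp1P _ _ G v (fun x => eqP (oK x))) := c1; move=> /(_ (s^-1%g u)).
  move: (s^-1%g u) => w /connectP[p pth ->].
  elim: p v pth => [|v' p IHp] v /=; first by rewrite connect0.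
  case/andP=> /existsP[x /andP[/eqP <- /eqP <-]] /IHp; apply: connect_trans.
  by apply: connect1; apply/existsP; exists (t x); rewrite hoppE !attE !eqxx.
apply/and5P; split=> //.
- by apply/forallP => x; rewrite oK'.
- have edg : #|edges G'| = #|edges G|.
    have := card_edges oK'; rewrite (card_edges (fun x => eqP (oK x))) ext'.
    by move/addnI/eqP; rewrite eqn_pmul2l // => /eqP.
  rewrite -(eqP gE) /genus /h1 edg (eqP c1) (eqP c1') (reindex_inj (@perm_inj _ s)).
  by under eq_bigr do rewrite genE.
- by rewrite ext'.
apply/forallP => v; rewrite -[v](permKV s) genE iso_valence.
by move/forallP: st; apply.
Qed.

End IsoInvariance.

(** Orbit counting: a class has k! m! / |Aut| labelled members, on which the
    product of Euler characteristics is constant. *)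
Lemma sum_stable_graph_reps g n k m :
  \sum_(c in stable_graph_reps g n k m) weight (decode c) =
  (k`! * m`!)%:R^-1 * \sum_(c : gcode (g + n) k m | stable_graph g n (decode c))
    \prod_v chiM (gen (decode c) v) (valence (decode c) v).
Proof.
pose D := [set c : gcode (g + n) k m | stable_graph g n (decode c)].
pose R (c c' : gcode (g + n) k m) := isomorphic (decode c) (decode c').
pose f (c : gcode (g + n) k m) := \prod_v chiM (gen (decode c) v) (valence (decode c) v).
set P := equivalence_partition R D.
rewrite /stable_graph_reps -/D -/R -/P.
have eqR : {in D & &, equivalence_rel R}.
  move=> x y z _ _ _; rewrite /R !isomorphicE; split; first exact: orbit_refl.
  by move=> /orbit_eqP ->.
have partP : partition P D by apply: equivalence_partitionP.
have tr := transversalP partP; set X := transversal P D.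
have XD : {subset X <= D} by apply/subsetP/(transversal_sub tr).
have blockE c : c \in D -> pblock P c = orbit (relabel_action _ _ _) setT c.
  move=> cD; apply/setP => y; rewrite -isomorphicE.
  have [yD|nyD] := boolP (y \in D); first by rewrite pblock_equivalence_partition.
  apply/idP/idP => [yP|/existsP[s /existsP[t iso]]].
    have := partP => /and3P[/eqP cov _ _]; case/negP: nyD; rewrite -cov.
    apply/bigcupP; exists (pblock P c) => //; apply: pblock_mem.
    by rewrite cov.
  case/negP: nyD; rewrite inE in cD; rewrite inE.
  exact: (iso_stable_graph iso cD).
have fE c y : y \in orbit (relabel_action _ _ _) setT c -> f y = f c.
  by rewrite -isomorphicE => /existsP[s /existsP[t iso]]; apply: iso_weight_prod iso.
have fact0 : (k`! * m`!)%:R != 0 :> rat by rewrite pnatr_eq0 -lt0n muln_gt0 !fact_gt0.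
rewrite -[RHS](_ : (k`! * m`!)%:R^-1 * (\sum_(c in D) f c) = _); last first.
  by congr (_ * _); apply: eq_bigl => c; rewrite inE.
have := partP => /and3P[/eqP cov tI _].
rewrite -cov big_trivIset //= -(pblock_transversal tr) [in RHS]big_imset /=; last first.
  exact: (pblock_inj tr).
rewrite mulr_sumr; apply: eq_bigr => c cX; have cD := XD _ cX.
rewrite blockE // (eq_bigr (fun=> f c)) => [|y /fE //].
rewrite sumr_const /weight -/(f c) -(card_orbit_Aut c) -[f c *+ _]mulr_natl natrM mulrA; congr (_ * _).
have a0 : #|Defs.Aut (decode c)|%:R != 0 :> rat.
  by apply: contraNneq fact0; rewrite -(card_orbit_Aut c) natrM => ->; rewrite mulr0.
have b0 : #|orbit (relabel_action (g + n) k m) setT c|%:R != 0 :> rat.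
  by apply: contraNneq fact0; rewrite -(card_orbit_Aut c) natrM => ->; rewrite mul0r.
by field; rewrite a0 b0.
Qed.

(** * Stable graphs and the coefficients of the two series *)

(** The graphs without external edges that contribute to the coefficient of
    z^(-N): connected, with stable vertices, and with the right degree. *)
Definition graded_graph (N : nat) (V H : finType) (G : wgraph V H) : bool :=
  [&& [forall x, (hopp G x != x) && (hopp G (hopp G x) == x)], ncomp G == 1%N,
      [forall v, 2 < 2 * gen G v + valence G v]%N
    & (\sum_v (2 * gen G v + valence G v) == N + 2 * #|V|)%N].

Lemma conn_sum_coef b k m N : (N < 2 * b)%N ->
  (conn_sum Vseries 'I_k 'I_m) N =
  \sum_(c : gcode b k m | graded_graph N (decode c))
    \prod_v chiM (gen (decode c) v) (valence (decode c) v).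
Proof.
move=> Nb; rewrite /conn_sum fps_sumE.
transitivity (\sum_(a : {ffun 'I_m -> 'I_k}) \sum_(o : {ffun 'I_m -> 'I_m})
   \sum_(c : {ffun 'I_k -> 'I_b.+1})
     if graded_graph N (decode ((a, o, c) : gcode b k m))
     then \prod_v chiM (c v) #|[set h | a h == v]| else 0).
  apply: eq_bigr => a _; rewrite fps_sumE big_mkcond /=; apply: eq_bigr => o _.
  rewrite /graded_graph /= -/(bare a o) -[[forall x, _]]/(fpf_inv o).
  rewrite -[ncomp (WGraph _ _ _)]/(ncomp (bare a o)).
  case: (fpf_inv o); last by rewrite big1.
  case: (ncomp _ == _); last by rewrite big1.
  rewrite /= /val_weight (@prod_Vseries_coef b) // [LHS]big_mkcond card_ord.
  by apply: eq_bigr => c _.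
by rewrite !pair_big /= [RHS]big_mkcond; apply: eq_bigr => -[[a o] c].
Qed.

(** Without external edges the valences add up to twice the number of edges, so
    that the degree condition is Euler's formula for the genus. *)
Lemma stable_graded g (V H : finType) (G : wgraph V H) : (0 < g)%N ->
  stable_graph g 0 G = graded_graph (2 * g - 2) G.
Proof.
move=> g0; rewrite /graded_graph /stable_graph.
have [oK|noK] := boolP [forall x, hopp G (hopp G x) == x]; last first.
  apply/esym/negbTE; rewrite negb_and; apply/orP; left; apply: contraNN noK.
  by move=> /forallP h; apply/forallP => x; case/andP: (h x).
have -> : [forall x, (hopp G x != x) && (hopp G (hopp G x) == x)] = (#|external G| == 0%N).
  rewrite cards_eq0; apply/forallP/eqP => [h|/setP ext0 x].
    by apply/setP => x; rewrite !inE; case/andP: (h x) => /negPf.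
  by have := ext0 x; rewrite !inE => ->; rewrite (forallP oK).
rewrite andTb; have [n1|] := boolP (ncomp G == 1%N); last by rewrite !andbF.
rewrite !andTb; have [ext0|] := boolP (#|external G| == 0%N); last by rewrite !(andbF, andFb).
rewrite !andTb andbC; congr (_ && _).
have cE := card_edges (fun x => eqP (forallP oK x)).
rewrite big_split /= sum_valence cE (eqP ext0) -big_distrr /= /genus /h1 (eqP n1).
by move: (\sum_v _)%N #|edges G| #|V| => a e k; apply/eqP/eqP; lia.
Qed.

(** Every stable vertex adds at least 3 to the sum, which equals N + 2 #|V|. *)
Lemma graded_graph_bounds N (V H : finType) (G : wgraph V H) : graded_graph N G ->
  [/\ (0 < #|V|)%N, (#|V| <= N)%N, (#|H| <= 3 * N)%N, ~~ odd N & ~~ odd #|H|].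
Proof.
case/and4P=> /forallP fo c1 /forallP st /eqP sE.
have V0 : (0 < #|V|)%N.
  have /card_gt0P[v _] : (0 < ncomp G)%N by rewrite (eqP c1).
  by apply/card_gt0P; exists v.
have le3 : (3 * #|V| <= \sum_v (2 * gen G v + valence G v))%N.
  by rewrite -sum1_card big_distrr leq_sum.
have oddH : ~~ odd #|H|.
  have oK x : hopp G (hopp G x) = x by case/andP: (fo x) => _ /eqP.
  rewrite (card_edges oK) (_ : external G = set0) ?cards0 ?oddM //.
  by apply/setP => x; rewrite !inE; case/andP: (fo x) => /negPf.
rewrite big_split /= sum_valence -big_distrr /= in sE le3.
have oddN : ~~ odd N.
  have oddE a b k (E : (2 * a + b = N + 2 * k)%N) : odd N = odd b.
    by have := congr1 odd E; rewrite !mul2n !oddD !odd_double addbF => <-.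
  by rewrite (oddE _ _ _ sE).
by move: sE le3 V0; move: (\sum_v _)%N #|V| #|H| => a k m sE le3 V0; split=> //; lia.
Qed.

Lemma conn_sum_coef0 k m N : ((N < k) || (3 * N < m) || odd N || (N == 0))%N ->
  (conn_sum Vseries 'I_k 'I_m) N = 0.
Proof.
move=> far; rewrite (@conn_sum_coef N.+1) ?big1 //; last by lia.
move=> c /graded_graph_bounds; rewrite !card_ord => -[k0 kN mN oN om].
by move: far; rewrite (negPf oN); lia.
Qed.

Lemma log_terms_coef0 e N : ((3 * N < 2 * e) || odd N || (N == 0))%N -> log_terms e N = 0.
Proof.
move=> far; rewrite (@log_terms_conn_sum e (2 * e).+2) ?addn1 // fps_sumE big1 // => k _.
rewrite fpsC_mulE conn_sum_coef0 ?mulr0 //.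
by case/orP: far => [/orP[]|] ->; rewrite ?orbT.
Qed.

Lemma log_terms_locally_finite : locally_finite [set: nat]%classic log_terms.
Proof.
move=> N; apply: (@sub_finite_set _ _ `I_(3 * N).+1); last exact: finite_II.
move=> e [_ ne] /=; rewrite ltnS leqNgt; apply: contraNN ne => lt.
by rewrite log_terms_coef0 //; apply/orP; left; apply/orP; left; lia.
Qed.

(** The part of the Bini-Harer sum with k vertices and m half-edges, as a sum
    over labelled graphs. *)
Definition stable_sum (g k m : nat) : rat :=
  (k`! * m`!)%:R^-1 * \sum_(c : gcode (g + 0) k m | stable_graph g 0 (decode c))
    \prod_v chiM (gen (decode c) v) (valence (decode c) v).

Lemma stable_sum_conn_sum g k m : (0 < g)%N ->
  stable_sum g k m = (k`! * m`!)%:R^-1 * (conn_sum Vseries 'I_k 'I_m) (2 * g - 2)%N.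
Proof.
move=> g0; rewrite (@conn_sum_coef (g + 0)); last by lia.
by congr (_ * _); apply: eq_bigl => c; rewrite stable_graded.
Qed.

Lemma stable_sum0 g k m : (0 < g)%N ->
  ((2 * g - 2 < k) || (3 * (2 * g - 2) < m))%N -> stable_sum g k m = 0.
Proof.
by move=> g0 far; rewrite stable_sum_conn_sum // conn_sum_coef0 ?mulr0 // far.
Qed.

Lemma stable_sum_odd g k m : (0 < g)%N -> odd m -> stable_sum g k m = 0.
Proof.
move=> g0 om; rewrite stable_sum_conn_sum // /conn_sum big1 ?mulr0 // => a _.
by apply: big1 => o /andP[/fpf_inv_even]; rewrite card_ord om.
Qed.

(** Outside of the bounds of [graded_graph_bounds] all terms vanish, so that the
    ranges of the two double sums can be adjusted to each other; graphs with an
    odd number of half-edges do not occur. *)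
Lemma chiMbar_log_series g : (2 <= g)%N -> chiMbar g 0 = log_series (2 * g - 2)%N.
Proof.
move=> g2; have g0 : (0 < g)%N by lia.
set N := (2 * g - 2)%N.
have -> : log_series N = \sum_(e < (3 * N).+1) log_terms e N.
  by apply: fsumT_ord => e lt; apply: log_terms_coef0; apply/orP; left; apply/orP; left; lia.
(* A common range for the number of vertices, whatever e <= 3 N is. *)
pose K := (2 * (3 * N).+1).+2.
transitivity (\sum_(e < (3 * N).+1) \sum_(k < K) stable_sum g k (2 * e)); last first.
  apply: eq_bigr => e _; rewrite (@log_terms_conn_sum e K); last by rewrite /K; have := ltn_ord e; lia.
  by rewrite fps_sumE; apply: eq_bigr => k _; rewrite fpsC_mulE stable_sum_conn_sum.
rewrite exchange_big /chiMbar fact0 mul1r addn0 -/N.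
rewrite -(big_ord_widen0 (f := fun k => \sum_(e < (3 * N).+1) stable_sum g k (2 * e)) (n := N.+1)).
- apply: eq_bigr => k _; rewrite -(sum_odd0 (f := stable_sum g k)); last first.
    by move=> i oi; apply: stable_sum_odd.
  rewrite -(big_ord_widen0 (f := stable_sum g k) (n := (3 * N).+1)); last 2 first.
  - by lia.
  - by move=> i lt; apply: stable_sum0 => //; rewrite -/N lt orbT.
  by apply: eq_bigr => m _; apply: sum_stable_graph_reps.
- by rewrite /K; lia.
by move=> k lt; rewrite big1 // => e _; apply: stable_sum0 => //; rewrite -/N lt.
Qed.

Lemma chiMbar_seriesE g : (2 <= g)%N -> chiMbar_series (2 * g - 2)%N = chiMbar g 0.
Proof.
move=> g2; rewrite /= -big_filter (_ : [seq _ <- _ | _] = [:: g]) ?big_seq1 //.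
apply: (irr_sorted_eq ltn_trans ltnn) => // [|i].
  by rewrite sorted_filter ?iota_ltn_sorted //; apply: ltn_trans.
rewrite mem_filter mem_index_iota inE; apply/idP/eqP; lia.
Qed.

Lemma chiMbar_series0 N : odd N || (N == 0)%N -> chiMbar_series N = 0.
Proof.
move=> far; rewrite /= big_seq_cond big1 // => g; rewrite mem_index_iota => /andP[g2 /eqP gE].
have oddE : odd N = false.
  by have := congr1 odd gE; rewrite mul2n oddD odd_double addbF => <-.
by move: far; rewrite oddE; lia.
Qed.

Theorem theorem4p10 :
  [/\ locally_finite [set: nat]%classic log_terms /\ locally_finite [set: nat]%classic Ahat_terms,
      chiMbar_series = log_series /\ log_series = Ahat_series
    & forall g : nat, (2 <= g)%N ->
        chiMbar g 0 = log_series (2 * g - 2)%N /\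
        chiMbar g 0 = Ahat_series (2 * g - 2)%N].
Proof.
have eqA : log_series = Ahat_series by rewrite /log_series /Ahat_series log_terms_Ahat_terms.
have eqC : chiMbar_series = log_series.
  apply: fpsP => N; have [far|near] := boolP (odd N || (N == 0)%N).
    rewrite chiMbar_series0 // [RHS](fsumT_ord (N := 0)) ?big_ord0 // => e _.
    by apply: log_terms_coef0; case/orP: far => ->; rewrite ?orbT.
  move: near; rewrite negb_or => /andP[oN N0].
  have NE : N = (2 * N./2.+1 - 2)%N by have := odd_double_half N; rewrite (negPf oN); lia.
  by rewrite NE chiMbar_seriesE ?chiMbar_log_series //; lia.
split; last by move=> g g2; rewrite -eqA chiMbar_log_series.
  by rewrite -log_terms_Ahat_terms; split; apply: log_terms_locally_finite.
by split; [exact: eqC | exact: eqA].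
Qed.
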